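(* Consider the $i$th stage $u_h^{(i)}$ of a cRKDG method. Suppose that the cell average of $u_h^{(i)}$ on $K$ can be written as a convex combination of cell averages of forward-Euler steps with $\mathcal F$ and $\pm\mathcal G$ for previous stages, i.e. of quantities $$\overline{u_h^{(j)}+\Delta t\,\mu_{ij}^{\mathcal F}\,\mathcal F(u_h^{(j)})}_K\quad\text{and}\quad \overline{u_h^{(j)}\pm\Delta t\,\mu_{ij}^{\pm\mathcal G}\,\mathcal G(u_h^{(j)})}_K\qquad\text{with } j<i,\ \mu_{ij}^{\mathcal F},\mu_{ij}^{\pm\mathcal G}>0.$$ If $$\lambda a_0\le\min_{j<i}\left(\frac{c_{\mathcal F}}{\mu_{ij}^{\mathcal F}},\frac{c_{\mathcal G}}{\mu_{ij}^{\pm\mathcal G}}\right),$$ then $$u_h^{(j)}\in B\text{ on }\overline S_K\text{ for all }j<i\quad\Longrightarrow\quad\overline{u_h^{(i)}}_K\in B.$$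
   Context: Equation: $\partial_t u+\nabla\cdot f(u)=0$ on $\Omega\subset\mathbb R^d$, $u$ with values in $\mathbb R^m$, $C^1$ flux $f=[f_1,\dots,f_d]$ with values in $\mathbb R^{m\times d}$; $B$ is a convex invariant region. Mesh and space: $\mathcal T_h=\{K\}$ is a mesh of $\Omega$; each cell $K$ has flat edges $e_{\ell,K}$, $\ell=1,\dots,l(K)$, with constant unit outer normals $\nu_{\ell,K}$ ($|e_{\ell,K}|:=1$ if $d=1$). $V_h=\{v\in L^2(\Omega): v|_K\in[Z^k(K)]^m\ \forall K\}$, where $k\ge1$ and $Z^k(K)$ is the space of polynomials of total degree $\le k$, or of degree $\le k$ in each variable. $v^{\rm int},v^{\rm ext}$ are the interior and exterior traces on $e_{\ell,K}$; $\overline v_K$ is the cell average on $K$. Quadrature: edge integrals are replaced by $\int_{e_{\ell,K}}v\,dl\approx |e_{\ell,K}|\sum_{\beta=1}^{s_\ell}\omega^{\rm B}_{\beta,\ell,K}v(x_{\beta,\ell,K})$ with $\omega^{\rm B}_{\beta,\ell,K}>0$, $\sum_\beta\omega^{\rm B}_{\beta,\ell,K}=1$. There is a convex decomposition, valid for all $v\in Z^k(K)$: $\overline v_K=\sum_{\alpha=1}^{s_K}\omega^{\rm I}_{\alpha,K}v(x_{\alpha,K})+\sum_{\ell=1}^{l(K)}\sum_{\beta=1}^{s_\ell}\omega^{\rm I}_{\beta,\ell,K}v(x_{\beta,\ell,K})$ with all weights in $(0,1)$ (hence summing to 1). $S_K=\{x_{\alpha,K},x_{\beta,\ell,K}\}$.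 ''$u_h\in B$ on $S_K$'' means $u_h(x_{\alpha,K})\in B$ and $u_h^{\rm int}(x_{\beta,\ell,K})\in B$ for all $\alpha,\beta,\ell$; ''$u_h\in B$ on $\overline S_K$'' means in addition $u_h^{\rm ext}(x_{\beta,\ell,K})\in B$ for all $\beta,\ell$. Operators (every edge integral $\int_{e_{\ell,K}}v\,dl$ being computed by the quadrature rule $|e_{\ell,K}|\sum_{\beta=1}^{s_\ell}\omega^{\rm B}_{\beta,\ell,K}v(x_{\beta,\ell,K})$): $\mathcal F(u_h)=-\nabla^{\rm DG}\cdot f(u_h)\in V_h$ and $\mathcal G(u_h)=-\nabla^{\rm loc}\cdot f(u_h)\in V_h$, where for all $v_h\in V_h$, $\int_K[\nabla^{\rm DG}\cdot f(u_h)]\cdot v_h\,dx=-\int_K f(u_h):\nabla v_h\,dx+\sum_\ell\int_{e_{\ell,K}}\widehat{f\cdot\nu_{\ell,K}}(u_h^{\rm int},u_h^{\rm ext})\cdot v_h\,dl$ with a numerical flux (e.g. Lax–Friedrichs: $\frac{f(u_h^{\rm int})+f(u_h^{\rm ext})}{2}\cdot\nu_{\ell,K}-\frac{\alpha_{\ell,K}}2(u_h^{\rm ext}-u_h^{\rm int})$, $\alpha_{\ell,K}=\max|\mathrm{eig}(\partial_uf\cdot\nu_{\ell,K})|$), and $\int_K[\nabla^{\rm loc}\cdot f(u_h)]\cdot v_h\,dx$ is given by the same formula with $\widehat{f\cdot\nu_{\ell,K}}$ replaced by $f(u_h^{\rm int})\cdot\nu_{\ell,K}$. Constants: $\lambda=\max_{\ell,K}\Delta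 t\,|e_{\ell,K}|/|K|$; $a_0=\max|\mathrm{eig}(\partial_uf(u)\cdot\nu_{\ell,K})|>0$, the maximum over all $\ell,K$ and over the relevant states $u$ (all $u\in B=[m,M]$ for scalar laws; all values of the numerical solutions involved for systems); $c_{\mathcal G}=\min_{\beta,\ell,K}\omega^{\rm I}_{\beta,\ell,K}/\omega^{\rm B}_{\beta,\ell,K}$. Problems covered: (a) scalar conservation laws with $B=[m,M]$, in 1D or 2D on Cartesian or triangular meshes; (b) the compressible Euler equations, $u=(\rho,m^\top,E)^\top$, $f(u)=(m;\ \frac1\rho m\otimes m+pI_d;\ (E+p)\frac m\rho)$, $p=(\gamma-1)(E-\frac{|m|^2}{2\rho})$, $\gamma>1$, $B=\{\rho>0,\ p>0\}$, on the same meshes; (c) other hyperbolic systems with convex $B$ having the Lax–Friedrichs splitting property ($u\in B$, $\nu$ unit, $a>0$ with $a\ge\max|\mathrm{eig}(\partial_uf(u)\cdot\nu)|$ imply $u\pm a^{-1}f(u)\cdot\nu\in B$) and the weak property for $\mathcal F$ stated next. In all cases $c_{\mathcal F}>0$ is a constant for which the following (known for (a), (b)) holds: if $\lambda a_0\le c_{\mathcal F}$ and $u_h\in B$ on $\overline S_K$, then $\overline{u_h+\Delta t\,\mathcal F(u_h)}_K\in B$ (for any time step $\Delta t>0$, $\lambda$ being computed with that time step). cRKDG method with strictly lower triangular Butcher matrix $(a_{ij})$ and weights $(b_i)$: $u_h^{(i)}=u_h^n+\Delta t\sum_{j=1}^{i-1}a_{ij}\mathcal G(u_h^{(j)})$,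 $i=1,\dots,s$; $u_h^{n+1}=u_h^n+\Delta t\sum_{i=1}^sb_i\mathcal F(u_h^{(i)})$; the last formula is also regarded as a stage ($i=s+1$). *)

(* Defs.v *)
From HB Require Import structures.
From mathcomp Require Import all_boot all_order all_algebra.
From mathcomp Require Import all_classical all_reals all_analysis.
Set Implicit Arguments. Unset Strict Implicit. Unset Printing Implicit Defensive.
Import Order.TTheory GRing.Theory Num.Theory.
Import numFieldNormedType.Exports.
Local Open Scope classical_set_scope.
Local Open Scope ring_scope.

Definition tcons (R : realType) (d : nat)
    (p : measurableTypeR R * d.-tuple (measurableTypeR R)) :
  d.+1.-tuple (measurableTypeR R) := [tuple of p.1 :: p.2].

Lemma measurable_tcons (R : realType) (d : nat) :
  measurable_fun setT (@tcons R d).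
Proof. exact: measurable_cons. Qed.

Section tuple_measure_succ.
Context (R : realType) (d : nat).
Variable mu :
  {sigma_finite_measure set (d.-tuple (measurableTypeR R)) -> \bar R}.

Definition lebesgue_succ :
  set (d.+1.-tuple (measurableTypeR R)) -> \bar R :=
  pushforward (@lebesgue_measure R \x mu)%E (@tcons R d).

Let push : {measure set (d.+1.-tuple (measurableTypeR R)) -> \bar R} :=
  measure_function_pushforward__canonical__measure_function_Measure
    (@lebesgue_measure R \x mu)%E (@measurable_tcons R d).

HB.instance Definition _ := isMeasure.Build _ _ _ lebesgue_succ
  (measure0 push) (measure_ge0 push) (@measure_semi_sigma_additive _ _ _ push).

Let sigma_finite_succ : sigma_finite setT lebesgue_succ.
Proof.
have /sigma_finiteP[F [TF ndF Foo]] := sigma_finiteT (@lebesgue_measure R).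
have /sigma_finiteP[G [TG ndG Goo]] := sigma_finiteT mu.
pose uncons (t : d.+1.-tuple (measurableTypeR R)) :
  measurableTypeR R * d.-tuple (measurableTypeR R) :=
  (thead t, [tuple of behead t]).
have measurable_uncons : measurable_fun setT uncons.
  apply/measurable_fun_pairP; split.
    exact: (@measurable_tnth _ (measurableTypeR R) _ ord0).
  exact: measurable_behead.
have tconsK : cancel (@tcons R d) uncons.
  by case=> x y; rewrite /uncons /tcons theadE /=; congr pair; apply/val_inj.
exists (fun n => uncons @^-1` (F n `*` G n)).
  rewrite -preimage_bigcup (_ : \bigcup_n _ = setT) ?preimage_setT //.
  rewrite -subTset => -[x y] _.
  have [i _ Fix] : (\bigcup_n F n) x by rewrite -TF.
  have [j _ Gjy] : (\bigcup_n G n) y by rewrite -TG.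
  exists (maxn i j) => //; split.
    by move: x Fix; exact/subsetPset/ndF/leq_maxl.
  by move: y Gjy; exact/subsetPset/ndG/leq_maxr.
move=> n; have [mF Fn] := Foo n; have [mG Gn] := Goo n; split.
  by rewrite -[X in measurable X]setTI; apply: measurable_uncons => //; exact: measurableX.
rewrite /lebesgue_succ /pushforward -comp_preimage.
rewrite (_ : uncons \o @tcons R d = id); last exact/funext.
by rewrite product_measure1E// lte_mul_pinfty// ge0_fin_numE.
Qed.

HB.instance Definition _ :=
  Measure_isSigmaFinite.Build _ _ _ lebesgue_succ sigma_finite_succ.
End tuple_measure_succ.

(* Lebesgue measure on R^d; for d = 0 it is the unit mass of a point. *)
Fixpoint lebesgue_tuple (R : realType) (d : nat) :
    {sigma_finite_measure set (d.-tuple (measurableTypeR R)) -> \bar R} :=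
  if d is d'.+1 then lebesgue_succ (lebesgue_tuple R d') else dirac [tuple].

Definition rv_of_tuple (R : realType) (d : nat)
    (t : d.-tuple (measurableTypeR R)) : 'rV[R]_d := \row_i tnth t i.

Definition vol (R : realType) (d : nat) (A : set 'rV[R]_d) : R :=
  fine (lebesgue_tuple R d (@rv_of_tuple R d @^-1` A)).

Definition vint (R : realType) (d : nat) (A : set 'rV[R]_d)
    (g : 'rV[R]_d -> R) : R :=
  \int[lebesgue_tuple R d]_(t in @rv_of_tuple R d @^-1` A) g (rv_of_tuple t).

Definition dotv (R : realType) (n : nat) (x y : 'rV[R]_n) : R :=
  \sum_i x 0 i * y 0 i.

Definition is_max (R : realType) (A : set R) (x : R) : Prop :=
  A x /\ ubound A x.

Definition is_min (R : realType) (A : set R) (x : R) : Prop :=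
  A x /\ lbound A x.

(* [base K l] and the orthonormal rows of [frame K l] are Cartesian coordinates
   on the hyperplane of the flat edge [edge K l].  [neigh K l] is the cell on
   the other side of the edge, or [None] if the edge lies on the boundary of
   the domain. *)
Record mesh (R : realType) (d : nat) := Mesh {
  cell : finType;
  body : cell -> set 'rV[R]_d;
  nedge : cell -> nat;
  edge : forall K : cell, 'I_(nedge K) -> set 'rV[R]_d;
  normal : forall K : cell, 'I_(nedge K) -> 'rV[R]_d;
  base : forall K : cell, 'I_(nedge K) -> 'rV[R]_d;
  frame : forall K : cell, 'I_(nedge K) -> 'M[R]_(d.-1, d);
  neigh : forall K : cell, 'I_(nedge K) -> option cell }.

(* The (d-1)-dimensional measure of a flat edge; it is 1 when d = 1. *)
Definition edge_size (R : realType) (d : nat) (M : mesh R d) (K : cell M)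
    (l : 'I_(nedge K)) : R :=
  vol [set y : 'rV[R]_d.-1 | edge l (base l + y *m frame l)].

Definition relint (R : realType) (d : nat) (M : mesh R d) (K : cell M)
    (l : 'I_(nedge K)) : set 'rV[R]_d :=
  [set x | edge l x /\
     \forall z \near x, dotv (z - x) (normal l) = 0 -> edge l z].

Definition flat_edge (R : realType) (d : nat) (M : mesh R d) (K : cell M)
    (l : 'I_(nedge K)) : Prop :=
  [/\ frame l *m (frame l)^T = 1%:M,
      frame l *m (normal l)^T = 0,
      edge l `<=` [set x | dotv (x - base l) (normal l) = 0] &
      edge l = closure (relint l)].

Definition outer_unit_normal (R : realType) (d : nat) (M : mesh R d)
    (K : cell M) (l : 'I_(nedge K)) : Prop :=
  dotv (normal l) (normal l) = 1 /\
  forall x, relint l x -> \forall t \near 0^'+,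
    body K (x - t *: normal l) /\ ~ body K (x + t *: normal l).

Definition mesh_of (R : realType) (d : nat) (Omega : set 'rV[R]_d)
    (M : mesh R d) : Prop :=
  [/\ open Omega /\ closure Omega = \bigcup_K @body R d M K,
      forall K : cell M, [/\ compact (body K),
        body K = closure (interior (body K)) & 0 < vol (body K)],
      forall K K' : cell M, K != K' ->
        interior (body K) `&` interior (body K') = set0,
      forall K : cell M,
        body K `\` interior (body K) = \bigcup_l @edge R d M K l /\
        forall l l' : 'I_(nedge K), l != l' -> relint l `&` relint l' = set0 &
      forall (K : cell M) (l : 'I_(nedge K)),
        [/\ flat_edge l, outer_unit_normal l &
          if neigh l is Some K' then K' != K /\ edge l `<=` body K'
          else edge l `<=` closure Omega `\` Omega]].

(* For d = 1 these are the meshes of intervals. *)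
Definition cartesian (R : realType) (d : nat) (M : mesh R d) : Prop :=
  exists g : 'I_d -> seq R, (forall i, sorted <%R (g i)) /\
  forall K : cell M, exists j : 'I_d -> nat,
    let lo i := (g i)`_(j i) in let hi i := (g i)`_(j i).+1 in
    [/\ forall i, ((j i).+1 < size (g i))%N,
        body K = [set x | forall i, lo i <= x 0 i <= hi i] &
        exists phi : 'I_(nedge K) -> 'I_d * bool, bijective phi /\
          forall l, edge l = [set x | body K x /\
            x 0 (phi l).1 = if (phi l).2 then hi (phi l).1 else lo (phi l).1]].

(* [phi l] is the vertex opposite to the edge [l]. *)
Definition triangular (R : realType) (d : nat) (M : mesh R d) : Prop :=
  forall K : cell M, exists p : 'I_3 -> 'rV[R]_d,
    let hull (Q : pred ('I_3 -> R)) := [set x | exists w : 'I_3 -> R,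
      [/\ forall a, 0 <= w a, \sum_a w a = 1, Q w & x = \sum_a w a *: p a]] in
    body K = hull xpredT /\
    exists phi : 'I_(nedge K) -> 'I_3, bijective phi /\
      forall l, edge l = hull (fun w => w (phi l) == 0).

Definition structured (R : realType) (d : nat) (M : mesh R d) : Prop :=
  ((d = 1)%N \/ (d = 2)%N) /\ cartesian M \/ (d = 2)%N /\ triangular M.

Inductive poly_kind := TotalDegree | CoordDegree.

Definition poly_fun (R : realType) (d : nat) (kind : poly_kind) (k : nat)
    (q : 'rV[R]_d -> R) : Prop :=
  exists c : {ffun 'I_d -> 'I_k.+1} -> R,
    (if kind is TotalDegree then forall a : {ffun 'I_d -> 'I_k.+1},
       (k < \sum_i a i)%N -> c a = 0 else True) /\
    forall x, q x = \sum_a c a * \prod_i x 0 i ^+ a i.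

(* A piecewise polynomial function, given on each cell by a polynomial map. *)
Definition dgfun (R : realType) (m d : nat) (M : mesh R d) : Type :=
  cell M -> 'rV[R]_d -> 'rV[R]_m.

(* [winI], [wedgI] are the interior and edge weights of the decomposition of
   cell averages and [wB] the weights of the edge quadratures.  [ghost] gives
   the exterior traces on the boundary of the domain (boundary conditions). *)
Record dg (R : realType) (m d : nat) := DG {
  dmesh :> mesh R d;
  kind : cell dmesh -> poly_kind;
  deg : nat;
  nin : cell dmesh -> nat;
  xin : forall K : cell dmesh, 'I_(nin K) -> 'rV[R]_d;
  winI : forall K : cell dmesh, 'I_(nin K) -> R;
  nedg : forall K : cell dmesh, 'I_(nedge K) -> nat;
  xedg : forall (K : cell dmesh) (l : 'I_(nedge K)), 'I_(nedg l) -> 'rV[R]_d;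
  wedgI : forall (K : cell dmesh) (l : 'I_(nedge K)), 'I_(nedg l) -> R;
  wB : forall (K : cell dmesh) (l : 'I_(nedge K)), 'I_(nedg l) -> R;
  numflux : forall K : cell dmesh, 'I_(nedge K) ->
    'rV[R]_m -> 'rV[R]_m -> 'rV[R]_m;
  ghost : dgfun m dmesh -> forall K : cell dmesh, 'I_(nedge K) ->
    'rV[R]_d -> 'rV[R]_m }.

Definition mean (R : realType) (d : nat) (M : mesh R d) (K : cell M)
    (g : 'rV[R]_d -> R) : R := vint (body K) g / vol (body K).

Definition cell_average (R : realType) (m d : nat) (M : mesh R d)
    (u : dgfun m M) (K : cell M) : 'rV[R]_m :=
  \row_c mean K (fun x => u K x 0 c).

Definition quadrature_ok (R : realType) (m d : nat) (D : dg R m d) : Prop :=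
  [/\ forall (K : cell D) (a : 'I_(nin K)),
        body K (xin a) /\ 0 < winI a < 1,
      forall (K : cell D) (l : 'I_(nedge K)) (b : 'I_(nedg l)),
        [/\ edge l (xedg b), 0 < wedgI b < 1 & 0 < wB b],
      forall (K : cell D) (l : 'I_(nedge K)), \sum_(b < nedg l) wB b = 1 &
      forall (K : cell D) (v : 'rV[R]_d -> R), poly_fun (kind K) (deg D) v ->
        mean K v = \sum_(a < nin K) winI a * v (xin a) +
          \sum_(l < nedge K) \sum_(b < nedg l) wedgI b * v (xedg b)].

Definition in_V (R : realType) (m d : nat) (D : dg R m d) (u : dgfun m D) :
    Prop :=
  forall (K : cell D) (c : 'I_m),
    poly_fun (kind K) (deg D) (fun x => u K x 0 c).

Definition trace_int (R : realType) (m d : nat) (D : dg R m d) (u : dgfun m D)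
    (K : cell D) (l : 'I_(nedge K)) (b : 'I_(nedg l)) : 'rV[R]_m :=
  u K (xedg b).

Definition trace_ext (R : realType) (m d : nat) (D : dg R m d) (u : dgfun m D)
    (K : cell D) (l : 'I_(nedge K)) (b : 'I_(nedg l)) : 'rV[R]_m :=
  if neigh l is Some K' then u K' (xedg b) else ghost u l (xedg b).

Definition on_S (R : realType) (m d : nat) (D : dg R m d)
    (B : set 'rV[R]_m) (u : dgfun m D) (K : cell D) : Prop :=
  (forall a : 'I_(nin K), B (u K (xin a))) /\
  forall (l : 'I_(nedge K)) (b : 'I_(nedg l)), B (trace_int u b).

Definition on_Sbar (R : realType) (m d : nat) (D : dg R m d)
    (B : set 'rV[R]_m) (u : dgfun m D) (K : cell D) : Prop :=
  on_S B u K /\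
  forall (l : 'I_(nedge K)) (b : 'I_(nedg l)), B (trace_ext u b).

Definition normal_flux (R : realType) (m d : nat)
    (f : 'rV[R]_m -> 'M[R]_(m, d)) (nu : 'rV[R]_d) (u : 'rV[R]_m) : 'rV[R]_m :=
  nu *m (f u)^T.

(* [w] in V is the discrete divergence of f(u) with edge flux [h]: the edge
   integrals are computed by the quadrature rule, the cell integrals are
   exact. *)
Definition is_div (R : realType) (m d : nat) (D : dg R m d)
    (f : 'rV[R]_m -> 'M[R]_(m, d))
    (h : forall (K : cell D) (l : 'I_(nedge K)), 'I_(nedg l) -> 'rV[R]_m)
    (u w : dgfun m D) : Prop :=
  in_V w /\ forall v : dgfun m D, in_V v -> forall K : cell D,
    vint (body K) (fun x => dotv (w K x) (v K x)) =
    - vint (body K) (fun x => \sum_c \sum_j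
        f (u K x) c j * 'D_(delta_mx 0 j) (fun y => v K y 0 c) x)
    + \sum_(l < nedge K) edge_size l *
        \sum_(b < nedg l) wB b * dotv (h K l b) (v K (xedg b)).

Definition opp_dg (R : realType) (m d : nat) (M : mesh R d) (u : dgfun m M) :
    dgfun m M := fun K x => - u K x.

(* F(u) = w and G(u) = w, as relations: they hold for at most one w on the cells
   and do not presuppose that f(u) is integrable for every u in V. *)
Definition is_F (R : realType) (m d : nat) (D : dg R m d)
    (f : 'rV[R]_m -> 'M[R]_(m, d)) (u w : dgfun m D) : Prop :=
  is_div f (fun K l b => numflux l (trace_int u b) (trace_ext u b))
    u (opp_dg w).

Definition is_G (R : realType) (m d : nat) (D : dg R m d)
    (f : 'rV[R]_m -> 'M[R]_(m, d)) (u w : dgfun m D) : Prop :=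
  is_div f (fun K l b => normal_flux f (normal l) (trace_int u b))
    u (opp_dg w).

Definition euler_step (R : realType) (m d : nat) (M : mesh R d)
    (u : dgfun m M) (c : R) (w : dgfun m M) : dgfun m M :=
  fun K x => u K x + c *: w K x.

Definition cfl_ratios (R : realType) (d : nat) (M : mesh R d) (dt : R) :
    set R :=
  [set r | exists (K : cell M) (l : 'I_(nedge K)),
     r = dt * edge_size l / vol (body K)].

Definition weight_ratios (R : realType) (m d : nat) (D : dg R m d) : set R :=
  [set r | exists (K : cell D) (l : 'I_(nedge K)) (b : 'I_(nedg l)),
     r = wedgI b / wB b].

(* Only real eigenvalues are considered, since the systems are hyperbolic; the
   library Jacobian acts on rows and is the transpose of the usual one. *)
Definition speeds (R : realType) (m d : nat) (f : 'rV[R]_m -> 'M[R]_(m, d))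
    (N : set 'rV[R]_d) (S : set 'rV[R]_m) : set R :=
  [set r | exists (nu : 'rV[R]_d) (u : 'rV[R]_m) (e : R),
     [/\ N nu, S u, eigenvalue ('J (normal_flux f nu) u) e & r = `|e|]].

Definition C1_near (R : realType) (m d : nat) (f : 'rV[R]_m -> 'M[R]_(m, d))
    (B : set 'rV[R]_m) : Prop :=
  exists U : set 'rV[R]_m, [/\ open U, B `<=` U &
    forall u, U u -> differentiable f u /\
      forall h, {for u, continuous (fun w => 'D_h f w)}].

Definition hyperbolic (R : realType) (m d : nat)
    (f : 'rV[R]_m -> 'M[R]_(m, d)) (B : set 'rV[R]_m) : Prop :=
  forall (nu : 'rV[R]_d) (u : 'rV[R]_m), dotv nu nu = 1 -> B u ->
    diagonalizable ('J (normal_flux f nu) u).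

Definition LF_splitting (R : realType) (m d : nat)
    (f : 'rV[R]_m -> 'M[R]_(m, d)) (B : set 'rV[R]_m) : Prop :=
  forall (u : 'rV[R]_m) (nu : 'rV[R]_d) (a : R),
    B u -> dotv nu nu = 1 -> 0 < a -> ubound (speeds f [set nu] [set u]) a ->
    B (u + a^-1 *: normal_flux f nu u) /\ B (u - a^-1 *: normal_flux f nu u).

Definition interval_region (R : realType) (lo hi : R) : set 'rV[R]_1 :=
  [set u | lo <= u 0 0 <= hi].

(* Euler states are rows (density, momentum, energy). *)
Definition density (R : realType) (d : nat) (u : 'rV[R]_(1 + d + 1)) : R :=
  (lsubmx (lsubmx u)) 0 0.

Definition momentum (R : realType) (d : nat) (u : 'rV[R]_(1 + d + 1)) :
    'rV[R]_d := rsubmx (lsubmx u).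

Definition energy (R : realType) (d : nat) (u : 'rV[R]_(1 + d + 1)) : R :=
  (rsubmx u) 0 0.

Definition pressure (R : realType) (d : nat) (gamma : R)
    (u : 'rV[R]_(1 + d + 1)) : R :=
  (gamma - 1) *
    (energy u - dotv (momentum u) (momentum u) / (2 * density u)).

Definition euler_flux (R : realType) (d : nat) (gamma : R)
    (u : 'rV[R]_(1 + d + 1)) : 'M[R]_(1 + d + 1, d) :=
  col_mx
    (col_mx (momentum u)
      ((density u)^-1 *: ((momentum u)^T *m momentum u)
        + (pressure gamma u)%:M))
    (((energy u + pressure gamma u) / density u) *: momentum u).

Definition euler_region (R : realType) (d : nat) (gamma : R) :
    set 'rV[R]_(1 + d + 1) :=
  [set u | 0 < density u /\ 0 < pressure gamma u].

Inductive problem (R : realType) : nat -> nat -> Type :=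
| Scalar (d : nat) (f : 'rV[R]_1 -> 'M[R]_(1, d)) (lo hi : R) : problem R 1 d
| Euler (d : nat) (gamma : R) : problem R (1 + d + 1) d
| System (m d : nat) (f : 'rV[R]_m -> 'M[R]_(m, d)) (B : set 'rV[R]_m) :
    problem R m d.
Arguments Scalar {R d}.
Arguments Euler {R}.
Arguments System {R m d}.

Definition flux (R : realType) (m d : nat) (P : problem R m d) :
    'rV[R]_m -> 'M[R]_(m, d) :=
  match P in problem _ m d return 'rV[R]_m -> 'M[R]_(m, d) with
  | Scalar _ f _ _ => f
  | Euler d gamma => @euler_flux R d gamma
  | System _ _ f _ => f
  end.

Definition region (R : realType) (m d : nat) (P : problem R m d) :
    set 'rV[R]_m :=
  match P in problem _ m d return set 'rV[R]_m with
  | Scalar _ _ lo hi => interval_region lo hi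
  | Euler d gamma => @euler_region R d gamma
  | System _ _ _ B => B
  end.

Definition covered (R : realType) (m d : nat) (P : problem R m d)
    (M : mesh R d) : Prop :=
  match P in problem _ m d return mesh R d -> Prop with
  | Scalar _ f lo hi => fun M =>
      [/\ lo <= hi, C1_near f (interval_region lo hi) & structured M]
  | Euler _ gamma => fun M => 1 < gamma /\ structured M
  | System _ _ f B => fun _ =>
      [/\ convex_set B, C1_near f B, hyperbolic f B & LF_splitting f B]
  end M.

Definition consistent (R : realType) (m d : nat) (P : problem R m d)
    (D : dg R m d) : Prop :=
  forall (K : cell D) (l : 'I_(nedge K)) (u : 'rV[R]_m), region P u ->
    numflux l u u = normal_flux (flux P) (normal l) u.

(* The values of [u] at the quadrature points, including exterior traces. *)
Definition values (R : realType) (m d : nat) (D : dg R m d) (u : dgfun m D) :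
    set 'rV[R]_m :=
  [set y | exists K : cell D, (exists a : 'I_(nin K), y = u K (xin a)) \/
     exists (l : 'I_(nedge K)) (b : 'I_(nedg l)),
       y = trace_int u b \/ y = trace_ext u b].

(* [S] is the set of states over which the maximal wave speed a0 is taken: the
   whole of B for a scalar law, and for a system any set containing the values
   of the numerical solutions [us]. *)
Definition relevant (R : realType) (m d : nat) (P : problem R m d)
    (D : dg R m d) (us : set (dgfun m D)) (S : set 'rV[R]_m) : Prop :=
  if P is Scalar _ _ _ _ then S = region P
  else forall u, us u -> values u `<=` S.

Definition normals (R : realType) (d : nat) (M : mesh R d) : set 'rV[R]_d :=
  [set nu | exists (K : cell M) (l : 'I_(nedge K)), nu = normal l].

Definition weak_property (R : realType) (m d : nat) (P : problem R m d)
    (D : dg R m d) (cF : R) : Prop :=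
  forall (dt lam a0 : R) (S : set 'rV[R]_m) (u w : dgfun m D) (K : cell D),
    0 < dt -> is_max (cfl_ratios D dt) lam ->
    relevant P [set u] S -> is_max (speeds (flux P) (normals D) S) a0 ->
    0 < a0 -> lam * a0 <= cF ->
    in_V u -> is_F (flux P) u w -> on_Sbar (region P) u K ->
    region P (cell_average (euler_step u dt w) K).

(* Stages are numbered from 1 to s and the (s+1)-st one is the solution at the
   next time level; [Fu i], [Gu i] are F(u i), G(u i). *)
Definition cRKDG (R : realType) (m d : nat) (P : problem R m d) (D : dg R m d)
    (s : nat) (a : nat -> nat -> R) (b : nat -> R) (dt : R) (un : dgfun m D)
    (u Fu Gu : nat -> dgfun m D) : Prop :=
  [/\ forall i j, (1 <= i <= s)%N -> (i <= j <= s)%N -> a i j = 0,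
      in_V un,
      forall i, (1 <= i <= s)%N ->
        [/\ in_V (u i), is_F (flux P) (u i) (Fu i) &
            is_G (flux P) (u i) (Gu i)],
      forall i, (1 <= i <= s)%N -> forall K x,
        u i K x = un K x + dt *: \sum_(1 <= j < i) a i j *: Gu j K x &
      forall K x,
        u s.+1 K x = un K x + dt *: \sum_(1 <= i < s.+1) b i *: Fu i K x].

(* Main.v *)
(** The average of [u + t G(u)] is computed by testing the local divergence
    with constants: by the quadrature rules it is a convex combination of
    point values [u(x)] and of states [u -/+ s f(u).nu] with [|s| a0 <= 1]
    under the time step restriction. The Lax-Friedrichs splitting property
    puts the latter in [B]; for the Euler equations it follows from the fact
    that [v.nu +/- c], with [v] the velocity and [c] the sound speed, are
    eigenvalues of the flux Jacobian. A scalar flux need not have the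
    splitting property, being determined by the equation only up to constants;
    but the normals of a cell, weighted by the edge sizes, sum to zero, so
    that [f(u)] may be replaced by [f(u) - f(lo)] for the lower bound and by
    [f(u) - f(hi)] for the upper bound, and the mean value theorem applies. *)
Require Import Defs.
From HB Require Import structures.
From mathcomp Require Import all_boot all_order all_algebra.
From mathcomp Require Import all_classical all_reals all_analysis.
From mathcomp Require Import ring lra.
Set Implicit Arguments. Unset Strict Implicit. Unset Printing Implicit Defensive.
Import Order.TTheory GRing.Theory Num.Theory.
Import numFieldNormedType.Exports.
Local Open Scope classical_set_scope.
Local Open Scope ring_scope.

(** * Convex combinations and cell averages *)

Lemma convex_setP (R : realType) (V : lmodType R) (B : set V) :
  convex_set B <-> forall x y t, 0 <= t <= 1 -> B x -> B y ->
    B (t *: x + (1 - t) *: y).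
Proof.
split=> [cB x y t /andP[t0 t1] Bx By|cB x y t /set_mem Bx /set_mem By].
  have := cB x y (Itv01 t0 t1) (mem_set Bx) (mem_set By).
  by move/set_mem.
by apply/mem_set/cB => //; rewrite ge0 le1.
Qed.

(* The cone over [B], with weights: unlike convex combinations, its elements can
   be added one at a time. *)
Definition weighted_in (R : realType) (V : lmodType R) (B : set V) (W : R)
    (X : V) : Prop :=
  (W = 0 /\ X = 0) \/ (0 < W /\ exists2 y, B y & X = W *: y).

Lemma weighted_in_scale (R : realType) (V : lmodType R) (B : set V) (w : R)
    (x : V) : 0 <= w -> B x -> weighted_in B w (w *: x).
Proof.
rewrite le_eqVlt => /predU1P[<-|w0] Bx; first by left; rewrite scale0r.
by right; split => //; exists x.
Qed.

Lemma weighted_inD (R : realType) (V : lmodType R) (B : set V) (W1 W2 : R)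
    (X1 X2 : V) : convex_set B ->
  weighted_in B W1 X1 -> weighted_in B W2 X2 ->
  weighted_in B (W1 + W2) (X1 + X2).
Proof.
move=> /convex_setP cB [[-> ->]|[w1 [y1 By1 ->]]]; first by rewrite !add0r.
case=> [[-> ->]|[w2 [y2 By2 ->]]].
  by rewrite !addr0; right; split => //; exists y1.
have w12 : 0 < W1 + W2 by exact: addr_gt0.
right; split => //.
exists ((W1 / (W1 + W2)) *: y1 + (1 - W1 / (W1 + W2)) *: y2).
  apply: cB => //; rewrite divr_ge0 ?(ltW w1) ?(ltW w12)//=.
  by rewrite ler_pdivrMr// mul1r lerDl ltW.
rewrite scalerDr !scalerA mulrBr mulr1 mulrC divfK ?gt_eqF//.
by congr (_ + _ *: _); rewrite addrAC subrr add0r.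
Qed.

Lemma weighted_in_sum (R : realType) (V : lmodType R) (B : set V) (I : Type)
    (r : seq I) (Q : pred I) (W : I -> R) (X : I -> V) : convex_set B ->
  (forall i, Q i -> weighted_in B (W i) (X i)) ->
  weighted_in B (\sum_(i <- r | Q i) W i) (\sum_(i <- r | Q i) X i).
Proof.
move=> cB QX; apply: (big_ind2 (weighted_in B)) => //; first by left.
by move=> W1 X1 W2 X2; exact: weighted_inD.
Qed.

Lemma weighted_in1 (R : realType) (V : lmodType R) (B : set V) (X : V) :
  weighted_in B 1 X -> B X.
Proof.
case=> [[/eqP]|[_ [y By ->]]]; first by rewrite oner_eq0.
by rewrite scale1r.
Qed.

(** * Polynomial spaces and averages of discrete divergences *)

Lemma poly_fun_cst (R : realType) (d k : nat) (kd : poly_kind) (y : R) :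
  @poly_fun R d kd k (fun=> y).
Proof.
exists (fun a => if a == [ffun=> ord0] then y else 0); split.
  case: kd => // a; case: eqP => // -> /=.
  by rewrite big1// => i _; rewrite ffunE.
move=> x; rewrite (bigD1 [ffun=> ord0])//= eqxx big1 ?mulr1.
  by rewrite big1 ?addr0// => a /negPf ->; rewrite mul0r.
by move=> i _; rewrite ffunE expr0.
Qed.

Lemma poly_fun_lin (R : realType) (d k : nat) (kd : poly_kind) (t : R)
    (p q : 'rV[R]_d -> R) :
  poly_fun kd k p -> poly_fun kd k q -> poly_fun kd k (fun x => p x + t * q x).
Proof.
move=> [c [c0 pE]] [e [e0 qE]]; exists (fun a => c a + t * e a); split.
  case: kd c0 e0 => // c0 e0 a ka.
  by rewrite c0// e0// mulr0 addr0.
move=> x; rewrite pE qE mulr_sumr -big_split; apply: eq_bigr => a _ /=.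
by rewrite mulrDl mulrA.
Qed.

Lemma in_V_cst (R : realType) (m d : nat) (D : dg R m d) (y : 'rV[R]_m) :
  in_V ((fun _ _ => y) : dgfun m D).
Proof. by move=> K c; exact: poly_fun_cst. Qed.

Lemma in_V_euler_step (R : realType) (m d : nat) (D : dg R m d)
    (u w : dgfun m D) (t : R) :
  in_V u -> in_V w -> in_V (euler_step u t w).
Proof.
move=> Vu Vw K c.
rewrite (_ : (fun x => _) = fun x => u K x 0 c + t * w K x 0 c).
  exact: poly_fun_lin.
by apply/funext => x; rewrite !mxE.
Qed.

Lemma cell_average_quadrature (R : realType) (m d : nat) (D : dg R m d)
    (u : dgfun m D) (K : cell D) :
  quadrature_ok D -> in_V u ->
  cell_average u K = \sum_(a < nin K) winI a *: u K (xin a) +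
    \sum_(l < nedge K) \sum_(b < nedg l) wedgI b *: trace_int u b.
Proof.
move=> [_ _ _ hQ] Vu; apply/rowP => c; rewrite !mxE (hQ _ _ (Vu K c)) !summxE.
congr (_ + _); first by apply: eq_bigr => a _; rewrite mxE.
apply: eq_bigr => l _; rewrite summxE; apply: eq_bigr => b _.
by rewrite mxE.
Qed.

(** Linearity is read off from the exact quadrature, which is a finite sum, so that no integrability
    has to be established. *)
Lemma cell_average_euler_step (R : realType) (m d : nat) (D : dg R m d)
    (u w : dgfun m D) (t : R) (K : cell D) :
  quadrature_ok D -> in_V u -> in_V w ->
  cell_average (euler_step u t w) K = cell_average u K + t *: cell_average w K.
Proof.
move=> hQ Vu Vw; rewrite !cell_average_quadrature//; last first.
  exact: in_V_euler_step.
rewrite scalerDr addrACA !scaler_sumr -!big_split; congr (_ + _) => /=.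
  by apply: eq_bigr => a _; rewrite scalerDr !scalerA (mulrC t).
apply: eq_bigr => l _; rewrite scaler_sumr -big_split; apply: eq_bigr => b _ /=.
by rewrite scalerDr !scalerA (mulrC t).
Qed.

Lemma vint0 (R : realType) (d : nat) (A : set 'rV[R]_d) :
  vint A (fun=> 0) = 0.
Proof. by rewrite /vint /Rintegral integral0. Qed.

(** The test functions are the constant unit vectors: their derivatives vanish, which removes the
    cell integral, and the dot product with them extracts one component. *)
Lemma cell_average_div (R : realType) (m d : nat) (D : dg R m d)
    (f : 'rV[R]_m -> 'M[R]_(m, d))
    (h : forall (K : cell D) (l : 'I_(nedge K)), 'I_(nedg l) -> 'rV[R]_m)
    (u w : dgfun m D) (K : cell D) :
  is_div f h u w ->
  cell_average w K = (vol (body K))^-1 *: \sum_(l < nedge K)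
    edge_size l *: \sum_(b < nedg l) wB b *: h K l b.
Proof.
move=> [_ hw]; apply/rowP => c; rewrite !mxE /mean mulrC; congr (_ * _).
have := hw _ (@in_V_cst R m d D (delta_mx 0 c)) K.
have dotc (x : 'rV[R]_m) : dotv x (delta_mx 0 c) = x 0 c.
  rewrite /dotv (bigD1 c)//= mxE !eqxx mulr1 big1 ?addr0// => i /negPf ic.
  by rewrite mxE eqxx ic mulr0.
under [X in vint _ X]eq_fun do rewrite dotc.
move=> ->; rewrite (_ : (fun x => _) = fun=> 0) ?vint0 ?oppr0 ?add0r.
  rewrite summxE; apply: eq_bigr => l _; rewrite mxE summxE; congr (_ * _).
  by apply: eq_bigr => b _; rewrite dotc mxE.
apply/funext => x; rewrite big1// => i _; rewrite big1// => j _.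
by rewrite derive_cst mulr0.
Qed.

(** The edge terms of the divergence carry the weights [wB]; writing [wB] as [wedgI] divided by
    their ratio merges them with the terms of [cell_average_quadrature] at the same nodes. *)
Lemma cell_average_G_step (R : realType) (m d : nat) (D : dg R m d)
    (f : 'rV[R]_m -> 'M[R]_(m, d)) (u w : dgfun m D) (t : R) (K : cell D) :
  quadrature_ok D -> in_V u -> is_G f u w ->
  cell_average (euler_step u t w) K =
    \sum_(a < nin K) winI a *: u K (xin a) +
    \sum_(l < nedge K) \sum_(b < nedg l) wedgI b *: (trace_int u b -
      (t * edge_size l / vol (body K) / (wedgI b / wB b)) *:
        normal_flux f (normal l) (trace_int u b)).
Proof.
move=> hQ Vu Gw; have [_ hW _ _] := hQ; have [Vw _] := Gw.
(* In [is_G] the divergence is [opp_dg w], so the step is read with both signs reversed. *)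
have -> : euler_step u t w = euler_step u (- t) (opp_dg w).
  by apply/funext => L; apply/funext => x; rewrite /euler_step scaleNr scalerN opprK.
rewrite cell_average_euler_step// (cell_average_div _ Gw).
rewrite cell_average_quadrature// -addrA; congr (_ + _).
rewrite scalerA scaler_sumr -big_split; apply: eq_bigr => l _ /=.
rewrite scalerA scaler_sumr -big_split; apply: eq_bigr => b _ /=.
have [_ /andP[w0 _] B0] := hW K l b.
rewrite scalerBr !scalerA -scaleNr; congr (_ + _ *: _).
set v := (vol _)^-1; by field; rewrite !gt_eqF.
Qed.

(** * Measurability of cells, and the total weight of the quadrature *)

Lemma nbhs_rV_ball (R : realType) (d : nat) (U : set 'rV[R]_d) (x : 'rV[R]_d) :
  open U -> U x ->
  exists2 e : R, 0 < e & forall y : 'rV[R]_d, (forall i, `|x 0 i - y 0 i| < e) -> U y.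
Proof.
rewrite openE => oU Ux; have /nbhs_ballP[e /= e0 eU] := oU x Ux.
exists e => // y xy; apply: eU; split=> // i j.
by rewrite (ord1 i); exact: xy.
Qed.

(** An open set is the union of the countably many cubes with rational centre and radius that it
    contains, and a cube is a finite intersection of preimages of intervals under the
    coordinates. *)
Lemma measurable_rv_open (R : realType) (d : nat) (U : set 'rV[R]_d) :
  open U -> measurable (@rv_of_tuple R d @^-1` U).
Proof.
move=> oU.
pose box (p : ('rV[rat]_d * rat)%type) : set 'rV[R]_d :=
  [set y | forall i, `|ratr (p.1 0 i) - y 0 i| < ratr p.2].
have -> : @rv_of_tuple R d @^-1` U =
    \bigcup_(p in [set p | box p `<=` U]) (@rv_of_tuple R d @^-1` box p).
  rewrite -preimage_bigcup; congr (_ @^-1` _).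
  apply/seteqP; split=> [x Ux|x [p pU /pU//]].
  have [e e0 eU] := nbhs_rV_ball oU Ux.
  have [r /andP[r0 re]] : exists r : rat, (0 < ratr r :> R) && (ratr r < e / 2).
    have [|r] := @rat_in_itvoo R 0 (e / 2); first by lra.
    by rewrite in_itv; exists r.
  have qP i : exists q : rat, x 0 i - ratr r < ratr q < x 0 i + ratr r.
    have [|q] := @rat_in_itvoo _ (x 0 i - ratr r) (x 0 i + ratr r); first by lra.
    by rewrite in_itv; exists q.
  (* The centre is within [r] of [x] in each coordinate and [2 r < e], so the cube contains [x] and
     stays within distance [e] of it. *)
  exists (\row_i sval (cid (qP i)), r).
    move=> y /= xy; apply: eU => i; move: (xy i); rewrite mxE.
    by case: cid => q /= /andP[]; rewrite !ltr_norml; lra.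
  by move=> i /=; rewrite mxE; case: cid => q /= /andP[]; rewrite ltr_norml; lra.
rewrite bigcup_mkcond; apply: countable_bigcupT_measurable => // -[q r].
case: ifP => // _.
have -> : @rv_of_tuple R d @^-1` box (q, r) = \bigcap_(i in [set: 'I_d])
    ((fun t => @tnth d (measurableTypeR R) t i) @^-1`
       `]ratr (q 0 i) - ratr r, ratr (q 0 i) + ratr r[%classic).
  apply/seteqP; split=> t /= tb i => [_|].
    have := tb i; rewrite /rv_of_tuple mxE /= in_itv/= ltr_norml; lra.
  have := tb i I; rewrite /rv_of_tuple mxE /= in_itv/= ltr_norml; lra.
apply: fin_bigcap_measurable; first exact: finite_finset.
move=> i _; rewrite -[X in measurable X]setTI.
by apply: (@measurable_tnth _ (measurableTypeR R) d i) => //; exact: measurable_itv.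
Qed.

Lemma measurable_rv_closed (R : realType) (d : nat) (A : set 'rV[R]_d) :
  closed A -> measurable (@rv_of_tuple R d @^-1` A).
Proof.
move=> /closed_openC/measurable_rv_open mA.
by rewrite -[A]setCK preimage_setC; exact: measurableC.
Qed.

(** Compact cells are closed, hence measurable, so that the integral of 1 is the volume, which is
    nonzero. *)
Lemma mean1 (R : realType) (d : nat) (M : mesh R d) (K : cell M) :
  compact (body K) -> 0 < vol (body K) -> mean K (fun=> 1) = 1.
Proof.
move=> cK vK; rewrite /mean /vint /Rintegral integral_cst.
  by rewrite mul1e -/(vol _) divff ?gt_eqF.
apply: measurable_rv_closed; apply: compact_closed cK.
exact: norm_hausdorff.
Qed.

(** The decomposition of averages is exact for the constant 1. *)
Lemma quadrature_weights (R : realType) (m d : nat) (D : dg R m d)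
    (Omega : set 'rV[R]_d) (K : cell D) :
  mesh_of Omega D -> quadrature_ok D ->
  \sum_(a < nin K) winI a +
    \sum_(l < nedge K) \sum_(b < nedg l) wedgI b = 1.
Proof.
move=> [_ /(_ K)[cK _ vK] _ _ _] [_ _ _ hQ].
rewrite -[RHS](mean1 cK vK) (hQ _ _ (@poly_fun_cst R d _ _ 1)).
congr (_ + _); first by apply: eq_bigr => a _; rewrite mulr1.
by apply: eq_bigr => l _; apply: eq_bigr => b _; rewrite mulr1.
Qed.

Lemma edge_size_ge0 (R : realType) (d : nat) (M : mesh R d) (K : cell M)
    (l : 'I_(nedge K)) : 0 <= edge_size l.
Proof. exact/fine_ge0/measure_ge0. Qed.

Lemma quadrature_mem (R : realType) (m d : nat) (D : dg R m d)
    (Omega : set 'rV[R]_d) (K : cell D) (B : set 'rV[R]_m)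
    (X : 'I_(nin K) -> 'rV[R]_m)
    (Y : forall l : 'I_(nedge K), 'I_(nedg l) -> 'rV[R]_m) :
  mesh_of Omega D -> quadrature_ok D -> convex_set B ->
  (forall a, B (X a)) -> (forall l b, B (Y l b)) ->
  B (\sum_(a < nin K) winI a *: X a +
     \sum_(l < nedge K) \sum_(b < nedg l) wedgI b *: Y l b).
Proof.
move=> hM hQ cB BX BY; apply: weighted_in1.
rewrite -(quadrature_weights K hM hQ); have [hI hE _ _] := hQ.
apply: weighted_inD => //; apply: weighted_in_sum => // i _.
  by apply: weighted_in_scale => //; have [_ /andP[/ltW]] := hI K i.
apply: weighted_in_sum => // b _.
by apply: weighted_in_scale => //; have [_ /andP[/ltW]] := hE K i b.
Qed.

(** * The Euler equations *)

Lemma dotvC (R : realType) (n : nat) (x y : 'rV[R]_n) : dotv x y = dotv y x.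
Proof. by apply: eq_bigr => i _; rewrite mulrC. Qed.

Lemma dotvDl (R : realType) (n : nat) (x y z : 'rV[R]_n) :
  dotv (x + y) z = dotv x z + dotv y z.
Proof. by rewrite -big_split; apply: eq_bigr => i _; rewrite !mxE mulrDl. Qed.

Lemma dotvZl (R : realType) (n : nat) (t : R) (x y : 'rV[R]_n) :
  dotv (t *: x) y = t * dotv x y.
Proof. by rewrite mulr_sumr; apply: eq_bigr => i _; rewrite !mxE mulrA. Qed.

Lemma dotvDr (R : realType) (n : nat) (x y z : 'rV[R]_n) :
  dotv z (x + y) = dotv z x + dotv z y.
Proof. by rewrite dotvC dotvDl !(dotvC z). Qed.

Lemma dotvZr (R : realType) (n : nat) (t : R) (x y : 'rV[R]_n) :
  dotv y (t *: x) = t * dotv y x.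
Proof. by rewrite dotvC dotvZl (dotvC y). Qed.

Lemma dotv_ge0 (R : realType) (n : nat) (x : 'rV[R]_n) : 0 <= dotv x x.
Proof. by apply: sumr_ge0 => i _; rewrite -expr2 sqr_ge0. Qed.

Lemma density_lin (R : realType) (d : nat) (t : R) (x y : 'rV[R]_(1 + d + 1)) :
  density (x + t *: y) = density x + t * density y.
Proof. by rewrite /density !mxE. Qed.

Lemma energy_lin (R : realType) (d : nat) (t : R) (x y : 'rV[R]_(1 + d + 1)) :
  energy (x + t *: y) = energy x + t * energy y.
Proof. by rewrite /energy !mxE. Qed.

Lemma momentum_lin (R : realType) (d : nat) (t : R) (x y : 'rV[R]_(1 + d + 1)) :
  momentum (x + t *: y) = momentum x + t *: momentum y.
Proof. by apply/rowP => i; rewrite /momentum !mxE. Qed.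

(** Multiplying the pressure by [2 * density u / (gamma - 1)], positive once the density is, gives a
    quadratic form in the state, free of divisions. *)
Lemma euler_regionP (R : realType) (d : nat) (gamma : R)
    (u : 'rV[R]_(1 + d + 1)) : 1 < gamma ->
  euler_region gamma u <->
  0 < density u /\ 0 < 2 * density u * energy u - dotv (momentum u) (momentum u).
Proof.
move=> g1; rewrite /euler_region /= /pressure.
have g0 : 0 < gamma - 1 by rewrite subr_gt0.
split=> -[r0 p0]; split => //.
  move: p0; rewrite pmulr_rgt0// subr_gt0 ltr_pdivrMr ?mulr_gt0//.
  by rewrite mulrC -subr_gt0.
rewrite pmulr_rgt0// subr_gt0 ltr_pdivrMr ?mulr_gt0//.
by rewrite mulrC -subr_gt0.
Qed.

(** Along a segment the form [2 rho E - |m|^2] is quadratic in the two weights; the square terms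
    have positive coefficients, and so has the mixed term by a Cauchy-Schwarz argument. *)
Lemma euler_region_convex (R : realType) (d : nat) (gamma : R) : 1 < gamma ->
  convex_set (@euler_region R d gamma).
Proof.
move=> g1; apply/convex_setP => x y t /andP[t0 t1].
move=> /(euler_regionP _ g1)[r1 e1] /(euler_regionP _ g1)[r2 e2].
apply/(euler_regionP _ g1); rewrite -[t *: x]add0r.
rewrite !density_lin !energy_lin !momentum_lin.
have z1 : density (0 : 'rV[R]_(1 + d + 1)) = 0 by rewrite /density !mxE.
have z2 : energy (0 : 'rV[R]_(1 + d + 1)) = 0 by rewrite /energy !mxE.
have z3 : momentum (0 : 'rV[R]_(1 + d + 1)) = 0.
  by apply/rowP => i; rewrite /momentum !mxE.
rewrite z1 z2 z3 !add0r !(dotvDl, dotvDr, dotvZl, dotvZr).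
rewrite (dotvC (momentum y) (momentum x)).
(* This square gives [2 p q C <= q^2 A + p^2 B] in the notation introduced below. *)
have := dotv_ge0 (density y *: momentum x + (- density x) *: momentum y).
rewrite !(dotvDl, dotvDr, dotvZl, dotvZr) (dotvC (momentum y) (momentum x)).
move: e1 e2 r1 r2; set A := dotv _ _; set B := dotv (momentum y) _.
set C := dotv (momentum x) (momentum y).
move: (density x) (density y) (energy x) (energy y) A B C => p q E F A B C.
move=> e1 e2 p0 q0 h; set s := 1 - t.
have s0 : 0 <= s by rewrite subr_ge0.
have st : 0 < s + t by rewrite subrK.
have C_lt : 0 < p * F + q * E - C.
  rewrite -(pmulr_rgt0 _ (mulr_gt0 p0 q0)).
  have : 0 < p * p * (2 * q * F - B) + q * q * (2 * p * E - A).
    by rewrite addr_gt0 ?mulr_gt0.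
  by move: h; nra.
(* For [s = 0] the combination is the first state; for [s > 0] the term carrying [s] alone is
   already positive, whatever [t >= 0] is. *)
have [s00|s0'] := eqVneq s 0.
  have -> : t = 1 by move: s00; rewrite /s; lra.
  by rewrite s00; split; lra.
have {s0'} s0' : 0 < s by rewrite lt_neqAle eq_sym s0'.
split; first by rewrite ltr_wpDl ?mulr_ge0 ?mulr_gt0// ltW.
rewrite [ltRHS](_ : _ = t * t * (2 * p * E - A) + s * s * (2 * q * F - B) +
  2 * t * s * (p * F + q * E - C)); last by ring.
rewrite ltr_wpDr//; first by rewrite !mulr_ge0// ltW.
by rewrite ltr_wpDl ?mulr_ge0 ?mulr_gt0// ltW.
Qed.

(** Differentiability and the value of the differential in one direction are carried together, so
    that derivatives of long formulas are assembled rule by rule and simplified once at the end. *)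
Definition diff_dir (R : realType) (V W : normedModType R) (x v : V)
    (f : V -> W) (y : W) : Prop :=
  differentiable f x /\ 'd f x v = y.

Lemma diff_dir_eq (R : realType) (V W : normedModType R) (x v : V)
    (f : V -> W) (y z : W) :
  diff_dir x v f y -> y = z -> diff_dir x v f z.
Proof. by move=> fy <-. Qed.

Lemma diff_dirD (R : realType) (V W : normedModType R) (x v : V)
    (f g : V -> W) (y z : W) :
  diff_dir x v f y -> diff_dir x v g z ->
  diff_dir x v (fun u => f u + g u) (y + z).
Proof.
move=> [df <-] [dg <-]; split; first exact: differentiableD.
by rewrite (diffD df dg).
Qed.

Lemma diff_dirN (R : realType) (V W : normedModType R) (x v : V)
    (f : V -> W) (y : W) :
  diff_dir x v f y -> diff_dir x v (fun u => - f u) (- y).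
Proof.
move=> [df <-]; split; first exact: differentiableN.
by rewrite (diffN df).
Qed.

Lemma diff_dir_cst (R : realType) (V W : normedModType R) (x v : V) (y : W) :
  diff_dir x v (fun=> y) 0.
Proof. by split; [exact: differentiable_cst|rewrite diff_cst]. Qed.

Lemma diff_dir_sum (R : realType) (V W : normedModType R) (x v : V) (n : nat)
    (f : 'I_n -> V -> W) (y : 'I_n -> W) :
  (forall i, diff_dir x v (f i) (y i)) ->
  diff_dir x v (fun u => \sum_i f i u) (\sum_i y i).
Proof.
elim: n f y => [|n ih] f y fy.
  by under eq_fun do rewrite big_ord0; rewrite big_ord0; exact: diff_dir_cst.
under eq_fun do rewrite big_ord_recl.
by rewrite big_ord_recl; apply: diff_dirD => //; exact: ih.
Qed.

Lemma diff_dirM (R : realType) (V : normedModType R) (x v : V)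
    (f g : V -> R) (y z : R) :
  diff_dir x v f y -> diff_dir x v g z ->
  diff_dir x v (fun u => f u * g u) (f x * z + g x * y).
Proof.
move=> [df <-] [dg <-]; split; first exact: differentiableM.
by rewrite (diffM df dg).
Qed.

Lemma diff_dirV (R : realType) (V : normedModType R) (x v : V)
    (f : V -> R) (y : R) : f x != 0 ->
  diff_dir x v f y -> diff_dir x v (fun u => (f u)^-1) (- (f x) ^- 2 * y).
Proof.
move=> fx [df <-]; split; first exact: differentiableV.
by rewrite (diffV df fx).
Qed.

Lemma diff_dirZl (R : realType) (V W : normedModType R) (x v : V)
    (f : V -> R) (y : R) (w : W) :
  diff_dir x v f y -> diff_dir x v (fun u => f u *: w) (y *: w).
Proof.
move=> [df <-]; split; first exact: differentiableZl.
by rewrite (diffZl w df).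
Qed.

Lemma diff_dir_coord (R : realType) (n : nat) (x v : 'rV[R]_n) (i : 'I_n) :
  diff_dir x v (fun u : 'rV[R]_n => u 0 i) (v 0 i).
Proof.
have dc := @differentiable_coord R 1 n x 0 i; split => //.
rewrite -deriveE//; have /rowP/(_ i) := derive_mx (@derivable_id R 'rV[R]_n x v).
by rewrite derive_id mxE.
Qed.

Lemma diff_dir_row (R : realType) (V : normedModType R) (n : nat) (x v : V)
    (f : V -> 'rV[R]_n) (y : 'rV[R]_n) :
  (forall c, diff_dir x v (fun u => f u 0 c) (y 0 c)) -> diff_dir x v f y.
Proof.
move=> fy; rewrite (row_sum_delta y).
rewrite (_ : f = fun u => \sum_c f u 0 c *: 'e_c).
  by apply: diff_dir_sum => c; exact: diff_dirZl.
by apply/funext => u; exact: row_sum_delta.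
Qed.

(** Since [v *m 'J f u] is the differential of [f] along [v], an eigenvector is a direction along
    which the differential is a multiple of [v]. *)
Lemma eigenvalue_jacobian (R : realType) (n : nat) (f : 'rV[R]_n -> 'rV[R]_n)
    (u v : 'rV[R]_n) (e : R) :
  v != 0 -> diff_dir u v f (e *: v) -> eigenvalue ('J f u) e.
Proof.
move=> v0 [df fe]; apply/eigenvalueP; exists v => //.
by rewrite /jacobian mul_rV_lin1.
Qed.

Lemma normal_flux_density (R : realType) (d : nat) (gamma : R) (nu : 'rV[R]_d)
    (u : 'rV[R]_(1 + d + 1)) :
  density (normal_flux (@euler_flux R d gamma) nu u) = dotv nu (momentum u).
Proof.
rewrite /density /normal_flux !mxE; apply: eq_bigr => j _.
by rewrite mxE /euler_flux !col_mxEu.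
Qed.

Lemma normal_flux_momentum (R : realType) (d : nat) (gamma : R)
    (nu : 'rV[R]_d) (u : 'rV[R]_(1 + d + 1)) :
  momentum (normal_flux (@euler_flux R d gamma) nu u) =
  (dotv nu (momentum u) / density u) *: momentum u + pressure gamma u *: nu.
Proof.
apply/rowP => i; rewrite /momentum /normal_flux !mxE.
transitivity (\sum_j (nu 0 j * momentum u 0 j / density u * momentum u 0 i +
    nu 0 j * (pressure gamma u *+ (i == j)))).
  apply: eq_bigr => j _; rewrite mxE /euler_flux col_mxEu col_mxEd !mxE.
  rewrite big_ord_recl big_ord0 addr0 !mxE mulrDr; congr (_ + _).
  by ring.
rewrite big_split /=; congr (_ + _); first by rewrite -!mulr_suml /momentum !mxE.
rewrite (bigD1 i)//= eqxx mulr1n big1 ?addr0; first by rewrite mulrC.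
by move=> j /negPf ji; rewrite eq_sym ji mulr0n mulr0.
Qed.

Lemma normal_flux_energy (R : realType) (d : nat) (gamma : R)
    (nu : 'rV[R]_d) (u : 'rV[R]_(1 + d + 1)) :
  energy (normal_flux (@euler_flux R d gamma) nu u) =
  (energy u + pressure gamma u) / density u * dotv nu (momentum u).
Proof.
rewrite [LHS]mxE [LHS]mxE mulr_sumr; apply: eq_bigr => j _.
rewrite mxE /euler_flux !col_mxEd mxE.
by rewrite mulrCA.
Qed.

Lemma diff_dir_euler (R : realType) (d : nat) (u v : 'rV[R]_(1 + d + 1))
    (f : 'rV[R]_(1 + d + 1) -> 'rV[R]_(1 + d + 1)) (y : 'rV[R]_(1 + d + 1)) :
  diff_dir u v (fun u => density (f u)) (density y) ->
  (forall i, diff_dir u v (fun u => momentum (f u) 0 i) (momentum y 0 i)) ->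
  diff_dir u v (fun u => energy (f u)) (energy y) ->
  diff_dir u v f y.
Proof.
move=> fr fm fe; apply: diff_dir_row => c.
case: (split_ordP c) => [c1 ->|c1 ->]; last first.
  by move: fe; rewrite /energy (ord1 c1); under eq_fun do rewrite mxE; rewrite mxE.
case: (split_ordP c1) => [c2 ->|c2 ->].
  by move: fr; rewrite /density (ord1 c2); under eq_fun do rewrite !mxE; rewrite !mxE.
by move: (fm c2); rewrite /momentum; under eq_fun do rewrite !mxE; rewrite !mxE.
Qed.

(* Acoustic waves: [kap] is plus or minus the sound speed. *)
Lemma euler_eigenvalue (R : realType) (d : nat) (gamma kap : R)
    (nu : 'rV[R]_d) (u : 'rV[R]_(1 + d + 1)) :
  1 < gamma -> 0 < density u -> dotv nu nu = 1 ->
  kap ^+ 2 = gamma * pressure gamma u / density u ->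
  eigenvalue ('J (normal_flux (@euler_flux R d gamma) nu) u)
    (dotv nu (momentum u) / density u + kap).
Proof.
move=> g1 r0 nu1 kap2; have rN0 : density u != 0 by rewrite gt_eqF.
pose vn := dotv nu (momentum u) / density u.
pose H := (energy u + pressure gamma u) / density u.
(* The classical acoustic eigenvector: density 1, momentum [v + kap nu] and energy [H + kap vn],
   where [v] is the velocity, [vn] its normal component and [H] the specific total enthalpy. *)
pose r : 'rV[R]_(1 + d + 1) :=
  row_mx (row_mx 1%:M ((density u)^-1 *: momentum u + kap *: nu))
    (H + kap * vn)%:M.
have r_rho : density r = 1 by rewrite /density /r row_mxKl row_mxKl mxE.
have r_m : momentum r = (density u)^-1 *: momentum u + kap *: nu.
  by rewrite /momentum /r row_mxKl row_mxKr.
have r_E : energy r = H + kap * vn by rewrite /energy /r row_mxKr mxE.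
have dr : diff_dir u r (@density R d) (density r).
  have := diff_dir_coord u r (lshift 1 (lshift d 0)).
  rewrite /density; under [X in _ -> diff_dir _ _ X _]eq_fun do rewrite !mxE.
  by rewrite !mxE.
have dE : diff_dir u r (@energy R d) (energy r).
  have := diff_dir_coord u r (rshift (1 + d) 0).
  rewrite /energy; under [X in _ -> diff_dir _ _ X _]eq_fun do rewrite !mxE.
  by rewrite !mxE.
have dm j : diff_dir u r (fun u => momentum u 0 j) (momentum r 0 j).
  have := diff_dir_coord u r (lshift 1 (rshift 1 j)).
  rewrite /momentum; under [X in _ -> diff_dir _ _ X _]eq_fun do rewrite !mxE.
  by rewrite !mxE.
have dq : diff_dir u r (fun u => dotv nu (momentum u)) (dotv nu (momentum r)).
  apply: diff_dir_sum => j; have := diff_dirM (diff_dir_cst u r (nu 0 j)) (dm j).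
  by rewrite mulr0 addr0.
have dM : diff_dir u r (fun u => dotv (momentum u) (momentum u))
    (2 * dotv (momentum u) (momentum r)).
  rewrite mulr_sumr; apply: diff_dir_sum => j.
  have := diff_dirM (dm j) (dm j).
  by rewrite -mulr2n mulr_natl.
have dV := @diff_dirV R _ u r (@density R d) _ rN0 dr.
(* Acoustic waves are isentropic: the pressure varies as the squared sound speed times the variation
   of the density, which is 1 along [r]. *)
have dp : diff_dir u r (pressure gamma) (kap ^+ 2).
  have d2r : 2 * density u != 0 by rewrite mulf_neq0.
  have h2 := @diff_dirV R _ u r (fun u => 2 * density u) _ d2r
    (diff_dirM (@diff_dir_cst R _ R u r 2) dr).
  have h1 := diff_dirM dM h2.
  apply: (diff_dir_eq (diff_dirM (@diff_dir_cst R _ R u r (gamma - 1))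
    (diff_dirD dE (diff_dirN h1)))).
  rewrite r_E r_rho r_m dotvDr !dotvZr (dotvC _ nu) /H /vn kap2 /pressure.
  by field.
have q_r : dotv nu (momentum r) = vn + kap.
  by rewrite r_m dotvDr !dotvZr nu1 mulr1 mulrC.
apply: (eigenvalue_jacobian (v := r)).
  by apply/eqP => r0'; move: r_rho => /eqP; rewrite r0' /density !mxE eq_sym oner_eq0.
rewrite -[dotv nu (momentum u) / density u]/vn.
apply: diff_dir_euler.
- under eq_fun do rewrite normal_flux_density.
  rewrite -[_ *: r]add0r density_lin r_rho mulr1 /density !mxE add0r -q_r.
  exact: dq.
- move=> i; under eq_fun do
    rewrite normal_flux_momentum mxE [X in X + _]mxE [X in _ + X]mxE.
  apply: (diff_dir_eq (diff_dirD (diff_dirM (diff_dirM dq dV) (dm i))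
    (diff_dirM dp (@diff_dir_cst R _ R u r (nu 0 i))))).
  rewrite -[(_ + kap) *: r]add0r momentum_lin r_rho q_r r_m /vn /momentum !mxE.
  by field.
- under eq_fun do rewrite normal_flux_energy.
  apply: (diff_dir_eq (diff_dirM (diff_dirM (diff_dirD dE dp) dV) dq)).
  rewrite -[(_ + kap) *: r]add0r energy_lin r_rho q_r r_E /vn /H /energy !mxE.
  by field.
Qed.

(** With [w = 1 + t v.nu] the new density is [rho w], and [2 rho E - |m|^2] becomes [p / (gamma - 1)
    * (2 rho w^2 - (gamma - 1) p t^2)], which is positive when [c^2 t^2 <= w^2], with [c] the sound
    speed. *)
Lemma euler_region_flux_step (R : realType) (d : nat) (gamma t : R)
    (nu : 'rV[R]_d) (u : 'rV[R]_(1 + d + 1)) :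
  1 < gamma -> euler_region gamma u -> dotv nu nu = 1 ->
  0 < 1 + t * (dotv nu (momentum u) / density u) ->
  gamma * pressure gamma u / density u * t ^+ 2 <=
    (1 + t * (dotv nu (momentum u) / density u)) ^+ 2 ->
  euler_region gamma (u + t *: normal_flux (@euler_flux R d gamma) nu u).
Proof.
move=> g1 [r0 p0] nu1; set w := 1 + _ => w0 hw.
have rN0 : density u != 0 by rewrite gt_eqF.
have g0 : 0 < gamma - 1 by rewrite subr_gt0.
apply/(euler_regionP _ g1); rewrite density_lin energy_lin momentum_lin.
rewrite normal_flux_density normal_flux_energy normal_flux_momentum.
split.
  rewrite [ltRHS](_ : _ = density u * w) ?mulr_gt0//.
  by rewrite /w; field.
rewrite !(dotvDl, dotvDr, dotvZl, dotvZr) nu1 (dotvC (momentum u) nu).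
rewrite [ltRHS](_ : _ = pressure gamma u / (gamma - 1) *
    (2 * density u * w ^+ 2 - (gamma - 1) * pressure gamma u * t ^+ 2)).
  rewrite mulr_gt0 ?divr_gt0// subr_gt0.
  have : gamma * pressure gamma u * t ^+ 2 <= density u * w ^+ 2.
    by rewrite -ler_pdivrMl// mulrC mulrAC.
  have : 0 <= pressure gamma u * t ^+ 2 by rewrite mulr_ge0 ?sqr_ge0 ?ltW.
  have : 0 < density u * w ^+ 2 by rewrite mulr_gt0 ?exprn_gt0.
  by move: (pressure gamma u) (w ^+ 2) => q z; lra.
by rewrite /w /pressure; field; rewrite rN0 gt_eqF.
Qed.

(** The bounds [|v.nu - c| <= a] and [|v.nu + c| <= a] give [c <= a - |v.nu|], so that both
    [t = 1/a] and [t = -1/a] meet the conditions of [euler_region_flux_step]. *)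
Lemma euler_LF_splitting (R : realType) (d : nat) (gamma : R) : 1 < gamma ->
  LF_splitting (@euler_flux R d gamma) (@euler_region R d gamma).
Proof.
move=> g1 u nu a Bu nu1 a0 ha; have [r0 p0] := Bu.
pose c2 := gamma * pressure gamma u / density u.
have c20 : 0 < c2.
  by rewrite divr_gt0// mulr_gt0//; exact: lt_trans ltr01 g1.
pose c := Num.sqrt c2; have c0 : 0 < c by rewrite sqrtr_gt0.
have cc : c ^+ 2 = c2 by rewrite sqr_sqrtr ?ltW.
set vn := dotv nu (momentum u) / density u.
have speed kap : kap ^+ 2 = c2 -> `|vn + kap| <= a.
  move=> kap2; apply: ha; exists nu, u, (vn + kap); split => //.
  exact: euler_eigenvalue.
have := speed c cc; have : `|vn - c| <= a by apply: speed; rewrite sqrrN.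
rewrite !ler_norml => /andP[h1 h2] /andP[h3 h4].
rewrite -scaleNr; split.
  apply: euler_region_flux_step => //; rewrite -/vn -/c2 -?cc.
    by rewrite [ltRHS](_ : _ = (a + vn) / a) ?divr_gt0//; [lra|field; rewrite gt_eqF].
  rewrite -exprMn ler_sqr ?nnegrE.
  - by rewrite ler_pdivrMr// mulrDl mul1r mulrAC mulVf ?gt_eqF// mul1r; lra.
  - by rewrite mulr_ge0 ?invr_ge0 ?ltW.
  - rewrite [leRHS](_ : _ = (a + vn) / a) ?divr_ge0//; [lra|exact: ltW|].
    by field; rewrite gt_eqF.
apply: euler_region_flux_step => //; rewrite -/vn -/c2 -?cc.
  by rewrite [ltRHS](_ : _ = (a - vn) / a) ?divr_gt0//; [lra|field; rewrite gt_eqF].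
rewrite sqrrN -exprMn ler_sqr ?nnegrE.
- by rewrite ler_pdivrMr// mulrDl mul1r mulrAC mulNr mulVf ?gt_eqF// mulN1r; lra.
- by rewrite mulr_ge0 ?invr_ge0 ?ltW.
- rewrite [leRHS](_ : _ = (a - vn) / a) ?divr_ge0//; [lra|exact: ltW|].
  by field; rewrite gt_eqF.
Qed.

(** * Edge normals of structured meshes *)

Lemma vol_point (R : realType) (A : set 'rV[R]_0) : A 0 -> vol A = 1.
Proof.
move=> A0; rewrite /vol (_ : @rv_of_tuple R 0 @^-1` A = setT).
  by rewrite [X in fine X](diracT _).
by apply/seteqP; split=> // t _; rewrite /preimage /= [rv_of_tuple t]thinmx0.
Qed.

Lemma vol_segment (R : realType) (a b : R) : a <= b ->
  vol [set y : 'rV[R]_1 | a <= y 0 0 <= b] = b - a.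
Proof.
move=> ab; rewrite /vol /= /lebesgue_succ /pushforward.
rewrite (_ : _ @^-1` _ = `[a, b]%classic `*` setT); last first.
  apply/seteqP; split=> -[x t] /=; rewrite /rv_of_tuple mxE /= in_itv /=.
    by rewrite (tnth_nth 0).
  by rewrite (tnth_nth 0) => -[].
rewrite product_measure1E//=.
rewrite [X in (_ * X)%E](diracT _) mule1.
rewrite lebesgue_measure_itv /= lte_fin.
by have [//|] := ltP a b; case: ltgtP ab => // -> _ _; rewrite /= subrr.
Qed.

Definition segment (R : realType) (d : nat) (p q : 'rV[R]_d) : set 'rV[R]_d :=
  [set x | exists2 t, 0 <= t <= 1 & x = p + t *: (q - p)].

Lemma segment_left (R : realType) (d : nat) (p q : 'rV[R]_d) : segment p q p.
Proof. by exists 0; rewrite ?lexx ?ler01// scale0r addr0. Qed.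

Lemma segment_right (R : realType) (d : nat) (p q : 'rV[R]_d) : segment p q q.
Proof. by exists 1; rewrite ?lexx ?ler01// scale1r addrC subrK. Qed.

Lemma dotvNl (R : realType) (n : nat) (x y : 'rV[R]_n) :
  dotv (- x) y = - dotv x y.
Proof. by rewrite -scaleN1r dotvZl mulN1r. Qed.

Lemma dotvBl (R : realType) (n : nat) (x y z : 'rV[R]_n) :
  dotv (x - y) z = dotv x z - dotv y z.
Proof. by rewrite dotvDl dotvNl. Qed.

Lemma edge_normal (R : realType) (d : nat) (Omega : set 'rV[R]_d)
    (M : mesh R d) (K : cell M) (l : 'I_(nedge K)) (x y : 'rV[R]_d) :
  mesh_of Omega M -> edge l x -> edge l y -> dotv (y - x) (normal l) = 0.
Proof.
move=> [_ _ _ _ /(_ K l)[[_ _ eb _] _ _]] /eb /= ex /eb /= ey.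
have -> : y - x = (y - base l) - (x - base l) by rewrite opprB addrA subrK.
by rewrite dotvBl ex ey subrr.
Qed.

(** Being the closure of its relative interior, a nonempty edge has a relative interior point, from
    which the outer normal can be followed backwards into the cell. This decides the signs of
    normals below. *)
Lemma inward_point (R : realType) (d : nat) (Omega : set 'rV[R]_d)
    (M : mesh R d) (K : cell M) (l : 'I_(nedge K)) :
  mesh_of Omega M -> edge l !=set0 ->
  exists x t, [/\ edge l x, 0 < t & body K (x - t *: normal l)].
Proof.
move=> [_ _ _ _ /(_ K l)[[_ _ _ eE] [_ out] _]] [p ep].
have [x rx] : relint l !=set0.
  apply/set0P/eqP => r0; move: ep; rewrite eE r0.
  by rewrite -((closure_id set0).1 closed0).
have [t [t0 [bt _]]] := filter_ex (filterI (nbhs_right_gt 0) (out x rx)).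
by exists x, t; split => //; case: rx.
Qed.

(** The quarter turn, which takes an edge vector to a multiple of the edge normal. *)
Definition rot (R : realType) (x : 'rV[R]_2) : 'rV[R]_2 :=
  \row_i (if i == 0 then - x 0 1 else x 0 0).

Lemma dotv2 (R : realType) (x y : 'rV[R]_2) :
  dotv x y = x 0 0 * y 0 0 + x 0 1 * y 0 1.
Proof.
rewrite /dotv !big_ord_recl big_ord0 addr0.
by rewrite (_ : lift _ _ = 1)//; exact: val_inj.
Qed.

Lemma row2P (R : realType) (x y : 'rV[R]_2) :
  x 0 0 = y 0 0 -> x 0 1 = y 0 1 -> x = y.
Proof.
move=> h0 h1; apply/rowP => i.
have [->|->] : i = 0 \/ i = 1 by case: i => [[|[|//]]] hi;
  [left|right]; exact: val_inj.
  exact: h0.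
exact: h1.
Qed.

Lemma rotE (R : realType) (x : 'rV[R]_2) :
  (rot x 0 0 = - x 0 1) * (rot x 0 1 = x 0 0).
Proof. by rewrite !mxE. Qed.

Lemma orthogonal_unit2 (R : realType) (n x : 'rV[R]_2) :
  dotv n n = 1 -> dotv x n = 0 -> x = dotv x (rot n) *: rot n.
Proof.
rewrite !dotv2 !rotE => n1 xn.
have n1' : n 0 0 * n 0 0 = 1 - n 0 1 * n 0 1 by rewrite -n1 addrK.
apply: row2P; rewrite mxE rotE.
  rewrite -[LHS]mulr1 -n1.
  have : n 0 0 * (x 0 0 * n 0 0 + x 0 1 * n 0 1) = 0 by rewrite xn mulr0.
  by lra.
rewrite -[LHS]mulr1 -n1.
have : n 0 1 * (x 0 0 * n 0 0 + x 0 1 * n 0 1) = 0 by rewrite xn mulr0.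
by lra.
Qed.

(** In the plane the frame is a single unit vector [t], equal to the turned normal up to sign; in
    the coordinate along [t] the edge is the interval between the coordinates of its end points. *)
Lemma edge_size_segment (R : realType) (Omega : set 'rV[R]_2) (M : mesh R 2)
    (K : cell M) (l : 'I_(nedge K)) (p q : 'rV[R]_2) :
  mesh_of Omega M -> edge l = segment p q ->
  edge_size l = `|dotv (q - p) (rot (normal l))|.
Proof.
move=> hM lE; have [_ _ _ _ /(_ K l)[[fr1 frn eb _] [n1 _] _]] := hM.
pose t : 'rV[R]_2 := frame l.
have tt1 : dotv t t = 1.
  move/matrixP/(_ 0 0): fr1; rewrite !mxE eqxx mulr1n => <-.
  by apply: eq_bigr => i _; rewrite mxE.
have tn : dotv t (normal l) = 0.
  move/matrixP/(_ 0 0): frn; rewrite !mxE => <-.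
  by apply: eq_bigr => i _; rewrite mxE.
have ep : edge l p by rewrite lE; exact: segment_left.
have eq : edge l q by rewrite lE; exact: segment_right.
have tE := orthogonal_unit2 n1 tn.
have t2 : dotv t (rot (normal l)) ^+ 2 = 1.
  by move: tt1; rewrite {1}tE dotvZl dotvC expr2.
have alongt x : dotv x (normal l) = 0 -> x = dotv x t *: t.
  move=> xn; rewrite {1}(orthogonal_unit2 n1 xn) tE dotvZr scalerA.
  by congr (_ *: _); rewrite mulrAC -expr2 t2 mul1r.
have pE := alongt _ (eb _ ep); have qE := alongt _ (eb _ eq).
set A := dotv (p - base l) t in pE; set B := dotv (q - base l) t in qE.
have qpE : q - p = (B - A) *: t.
  by rewrite scalerBl -pE -qE opprB addrA subrK.
have -> : edge_size l = `|B - A|.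
  rewrite /edge_size.
  (* The order of the end points along [t] is unknown, hence the minimum and maximum. *)
  rewrite (_ : [set y | _] = [set y : 'rV[R]_1 | Num.min A B <= y 0 0 <= Num.max A B]).
    rewrite vol_segment ?ge_min ?le_max ?lexx//.
    by case: (leP A B) => AB; [rewrite ger0_norm|rewrite ltr0_norm];
      rewrite ?subr_ge0 ?subr_lt0 ?opprB.
  have yE (y : 'rV[R]_1) : base l + y *m frame l = p + (y 0 0 - A) *: t.
    rewrite scalerBl -pE opprB addrCA [p + _]addrC subrK addrC; congr (_ + _).
    apply/rowP => i; rewrite !mxE big_ord_recl big_ord0 addr0.
    by congr (_ * _); congr (frame l _ _); exact: val_inj.
  have tinj (a b : R) : a *: t = b *: t -> a = b.
    move=> /(congr1 (fun x => dotv x t)); rewrite !dotvZl tt1.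
    by rewrite !mulr1.
  apply/seteqP; split=> y /=; rewrite lE yE.
    move=> [s /andP[s0 s1] /addrI]; rewrite qpE scalerA => /tinj yA.
    have -> : y 0 0 = A + s * (B - A) by rewrite -yA addrC subrK.
    by case: (leP A B) => AB; apply/andP; split; nra.
  (* A degenerate edge is a single point, for which the quotient below would divide by zero. *)
  move=> hy; have [BA|BA] := eqVneq B A.
    exists 0; first by rewrite lexx ler01.
    move: hy; rewrite BA minxx maxxx => /le_anti <-.
    by rewrite subrr !scale0r.
  exists ((y 0 0 - A) / (B - A)).
    move: hy BA; case: (ltgtP A B) => [AB|AB|_]; last by [].
      have BA0 : 0 < B - A by rewrite subr_gt0.
      move=> /andP[y0 y1] _.
      by rewrite divr_ge0 ?subr_ge0 ?(ltW AB)//= ler_pdivrMr// mul1r lerD2r.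
    have BA0 : 0 < A - B by rewrite subr_gt0.
    move=> /andP[y0 y1] _; rewrite -mulrNN -invrN !opprB.
    by rewrite divr_ge0 ?subr_ge0 ?(ltW AB)//= ler_pdivrMr// mul1r lerD2l lerN2.
  by rewrite qpE scalerA divfK// subr_eq0.
rewrite qpE dotvZl normrM [X in _ * X](_ : _ = 1) ?mulr1//.
by apply/eqP; rewrite -(@pexpr_eq1 _ _ 2)// -normrX t2 normr1.
Qed.

(** Addition in ['I_3] is modulo 3, so [a], [a + 1], [a + 2] list the vertices starting anywhere. *)
Lemma sum_ord3 (V : nmodType) (F : 'I_3 -> V) (a : 'I_3) :
  \sum_i F i = F a + F (a + 1) + F (a + 2).
Proof.
rewrite (reindex_inj (addrI a)) !big_ord_recl big_ord0 /=.
rewrite (addr0 (F _)) addrA; congr (_ + _ + _); congr F; first exact: addr0.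
  by congr (a + _); exact: val_inj.
by congr (a + _); exact: val_inj.
Qed.

(** The normal is orthogonal to [q - p], so the two sides agree up to sign; the sign is settled by
    the third vertex [r], which lies on the inner side of the edge. *)
Lemma scaled_normal_triangle (R : realType) (Omega : set 'rV[R]_2)
    (M : mesh R 2) (K : cell M) (l : 'I_(nedge K)) (p q r : 'rV[R]_2) :
  mesh_of Omega M -> edge l = segment p q ->
  (forall x, body K x -> exists a b c, [/\ 0 <= c, a + b + c = 1 &
     x = a *: p + b *: q + c *: r]) ->
  edge_size l *: normal l =
    - Num.sg (dotv (rot (q - p)) (r - p)) *: rot (q - p).
Proof.
move=> hM lE hK; have [_ _ _ _ /(_ K l)[_ [n1 _] _]] := hM.
have ep : edge l p by rewrite lE; exact: segment_left.
have eq : edge l q by rewrite lE; exact: segment_right.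
have rn : dotv (r - p) (normal l) < 0.
  have [x [t [ex t0 /hK[a [b [c [c0 abc xE]]]]]]] : exists x t,
      [/\ edge l x, 0 < t & body K (x - t *: normal l)].
    by apply: inward_point hM _; exists p.
  (* Measured from [p] along the normal, only the share [c] of [r] in the inward point counts. *)
  have h : - t = c * dotv (r - p) (normal l).
    transitivity (dotv (x - t *: normal l - p) (normal l)).
      by rewrite addrAC dotvBl (edge_normal hM ep ex) dotvZl n1 mulr1 add0r.
    rewrite xE (_ : a *: p + b *: q + c *: r - p =
        b *: (q - p) + c *: (r - p)); last first.
      have -> : a = 1 - b - c by rewrite -abc; ring.
      by apply/rowP => i; rewrite !mxE; ring.
    by rewrite (dotvDl (b *: (q - p))) !dotvZl (edge_normal hM ep eq) mulr0 add0r.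
  have : c * dotv (r - p) (normal l) < 0 by rewrite -h oppr_lt0.
  by rewrite ltNge => /negP hc; rewrite ltNge; apply/negP => /(mulr_ge0 c0).
have qp := orthogonal_unit2 n1 (edge_normal hM ep eq).
rewrite (edge_size_segment hM lE); set s := dotv (q - p) _ in qp *.
have -> : rot (q - p) = - s *: normal l.
  by rewrite qp; apply: row2P; rewrite !mxE /=; ring.
(* As [r] is on the inner side, the sign is that of [s], and its product with [s] gives [|s|]. *)
rewrite dotvZl scalerA mulNr mulrN opprK sgrM sgrN.
rewrite (dotvC (normal l)) (ltr0_sg rn) normrEsg.
by congr (_ *: _); ring.
Qed.

(** Each scaled normal is an edge vector turned by a right angle, with one sign for all three, and
    the edge vectors of a triangle sum to zero. *)
Lemma triangular_normals (R : realType) (Omega : set 'rV[R]_2)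
    (M : mesh R 2) (K : cell M) :
  mesh_of Omega M -> triangular M ->
  \sum_(l < nedge K) edge_size l *: normal l = 0.
Proof.
move=> hM /(_ K)[p [KE [phi [phi_bij lE]]]].
(* Twice the signed area of the triangle, hence independent of the vertex [a]. *)
pose D a := dotv (rot (p (a + 2) - p (a + 1))) (p a - p (a + 1)).
have Dcyc a : D a = D 0.
  have h b : D (b + 1) = D b.
    rewrite /D -!addrA (_ : 1 + 2 = 0 :> 'I_3); last exact: val_inj.
    by rewrite -[1 + 1]/2 addr0 !dotv2 !mxE /=; ring.
  have [->|[->|->]] : a = 0 \/ a = 0 + 1 \/ a = 0 + 1 + 1; rewrite ?h//.
  case: a => [[|[|[|//]]]] ha; [left|right; left|right; right]; exact: val_inj.
pose F (a : 'I_3) := - Num.sg (D 0) *: rot (p (a + 2) - p (a + 1)).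
transitivity (\sum_(l < nedge K) F (phi l)).
  apply: eq_bigr => l _; rewrite /F -(Dcyc (phi l)); set a := phi l.
  apply: (scaled_normal_triangle hM).
    rewrite lE -/a; apply/seteqP; split=> x /=.
      move=> [w [w0 w1 /eqP wa ->]]; exists (w (a + 2)).
        rewrite w0 -w1 (sum_ord3 _ a) wa add0r lerDr; exact: w0.
      rewrite (sum_ord3 _ a) wa scale0r add0r.
      move: w1; rewrite (sum_ord3 _ a) wa add0r => /(canRL (addrK _)) ->.
      by apply/rowP => i; rewrite !mxE; ring.
    move=> [t /andP[t0 t1] ->].
    exists (fun b => if b == a then 0 else if b == a + 2 then t else 1 - t).
    have a1 : (a + 1 == a) = false by rewrite -subr_eq0 addrAC subrr add0r.
    have a2 : (a + 2 == a) = false by rewrite -subr_eq0 addrAC subrr add0r.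
    have a12 : (a + 1 == a + 2) = false by rewrite (inj_eq (addrI a)).
    split.
    - by move=> b; case: ifP => // _; case: ifP => // _; rewrite subr_ge0.
    - by rewrite (sum_ord3 _ a) eqxx a1 a2 a12 eqxx add0r subrK.
    - by rewrite eqxx.
    - rewrite (sum_ord3 _ a) eqxx a1 a2 a12 eqxx.
      by apply/rowP => i; rewrite !mxE; ring.
  rewrite KE => x /= [w [w0 w1 _ ->]].
  exists (w (a + 1)), (w (a + 2)), (w a); split => //.
    by rewrite -w1 (sum_ord3 _ a); ring.
  by rewrite (sum_ord3 _ a) -addrA addrC.
rewrite (_ : \sum_(l < nedge K) F (phi l) = \sum_a F a); last first.
  by rewrite [RHS](reindex phi (onW_bij _ phi_bij)).
rewrite /F -scaler_sumr.
rewrite [X in _ *: X](_ : _ = 0) ?scaler0//.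
rewrite (sum_ord3 _ 0) !add0r (_ : 1 + 2 = 0 :> 'I_3); last exact: val_inj.
rewrite -[1 + 1]/2.
rewrite (_ : 2 + 2 = 1 :> 'I_3); last exact: val_inj.
rewrite (_ : 2 + 1 = 0 :> 'I_3); last exact: val_inj.
by apply: row2P; rewrite !mxE /=; ring.
Qed.

(** Each normal is plus or minus a basis vector and opposite edges have the same size, so that they
    cancel in pairs. *)
Lemma cartesian_normals (R : realType) (d : nat) (Omega : set 'rV[R]_d)
    (M : mesh R d) (K : cell M) :
  (d = 1)%N \/ (d = 2)%N -> mesh_of Omega M -> cartesian M ->
  \sum_(l < nedge K) edge_size l *: normal l = 0.
Proof.
move=> d12 hM [g [g_sorted /(_ K)[j [j_lt KE [phi [phi_bij lE]]]]]].
pose lo i := (g i)`_(j i); pose hi i := (g i)`_(j i).+1.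
have lohi i : lo i < hi i.
  by apply: (sorted_ltn_nth lt_trans) => //; rewrite inE// ltnW.
pose side (l : 'I_(nedge K)) (i : 'I_d) : R :=
  if (phi l).2 then hi i else lo i.
pose corner (l : 'I_(nedge K)) (h : 'I_d -> R) : 'rV[R]_d :=
  \row_i (if i == (phi l).1 then side l i else h i).
have sideP l i : lo i <= side l i <= hi i.
  by rewrite /side; case: ifP => _; rewrite lexx (ltW (lohi i)).
have edgeP l x : edge l x <->
    (forall i, lo i <= x 0 i <= hi i) /\ x 0 (phi l).1 = side l (phi l).1.
  by rewrite lE /= KE /side; split=> -[h ->]; split => //; case: ifP.
have corner_edge l h : (forall i, lo i <= h i <= hi i) -> edge l (corner l h).
  move=> hh; apply/edgeP; split=> [i|]; last by rewrite mxE eqxx.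
  by rewrite mxE; case: ifP.
have lo_in i : lo i <= lo i <= hi i by rewrite lexx ltW.
have hi_in i : lo i <= hi i <= hi i by rewrite lexx ltW.
have nE l : normal l = (if (phi l).2 then 1 else -1) *: 'e_(phi l).1.
  have [_ _ _ _ /(_ K l)[_ [n1 _] _]] := hM.
  (* Two points of the edge that differ only in coordinate [i] force that component of the normal to
     vanish. *)
  have n0 i : i != (phi l).1 -> normal l 0 i = 0.
    move=> iNa; pose h k := if k == i then hi k else lo k.
    have h_in k : lo k <= h k <= hi k by rewrite /h; case: ifP.
    have := edge_normal hM (corner_edge l lo lo_in) (corner_edge l h h_in).
    rewrite /dotv (bigD1 i)//= big1 ?addr0.
      rewrite !mxE (negPf iNa) /h eqxx => /eqP; rewrite mulf_eq0 => /orP[|/eqP//].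
      by rewrite subr_eq0 gt_eqF.
    move=> k /negPf ki; rewrite !mxE /h ki.
    by case: ifP => _; rewrite subrr mul0r.
  have nn : normal l 0 (phi l).1 ^+ 2 = 1.
    rewrite -n1 /dotv (bigD1 (phi l).1)//= big1 ?addr0 ?expr2// => k /n0 ->.
    by rewrite mul0r.
  (* Of the two unit values left, the inward point excludes the one pointing into the cell. *)
  have [x [t [/edgeP[_ xa] t0 xK]]] : exists x t,
      [/\ edge l x, 0 < t & body K (x - t *: normal l)].
    by apply: inward_point hM _; exists (corner l lo); exact: corner_edge.
  move: xK; rewrite KE => /= /(_ (phi l).1); rewrite -/(lo _) -/(hi _) !mxE xa.
  move=> /andP[x0 x1]; apply/rowP => i; rewrite !mxE eqxx /=.
  have [->|/n0 ->] := eqVneq i (phi l).1; last by rewrite mulr0.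
  rewrite mulr1; move/eqP: nn; rewrite sqrf_eq1; move: x0 x1; rewrite /side.
  by case: ifP => _ x0 x1 /orP[] /eqP nl //; move: x0 x1; rewrite nl; lra.
pose L a := \prod_(i | i != a) (hi i - lo i).
have sizeE l : edge_size l = L (phi l).1.
  case: d12 => dE; subst d.
    rewrite /L big_pred0; last by move=> i; rewrite !ord1 eqxx.
    (* In dimension 1 the edge is measured in a space with a single point, so it suffices that
       [base l] lies on the edge. *)
    apply: vol_point; rewrite /= mul0mx addr0.
    have := corner_edge l lo lo_in; set x := corner l lo => ex.
    have [_ _ _ _ /(_ K l)[[_ _ eb _] _ _]] := hM.
    suff -> : base l = x by [].
    apply/esym/subr0_eq/rowP => i; have := eb x ex.
    rewrite /= /dotv big_ord_recl big_ord0 addr0 nE !mxE !ord1 eqxx mulr1 => /eqP.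
    by rewrite mulf_eq0 => /orP[/eqP//|]; case: ifP; rewrite ?oppr_eq0 oner_eq0.
  have segE : edge l = segment (corner l lo) (corner l hi).
    apply/seteqP; split=> x.
      move=> /edgeP[xin xa].
      pose o := (phi l).1 + 1.
      have oE i : i != (phi l).1 -> i = o.
        by move: i (phi l).1 @o => [[|[|//]] ?] [[|[|//]] ?] /= => [/eqP[]|_|_|/eqP[]] //;
          exact: val_inj.
      have oN : o != (phi l).1 by rewrite /o -subr_eq0 addrAC subrr.
      have lho : 0 < hi o - lo o by rewrite subr_gt0.
      exists ((x 0 o - lo o) / (hi o - lo o)).
        have /andP[x0 x1] := xin o.
        by rewrite divr_ge0 ?subr_ge0 ?(ltW (lohi o))//= ler_pdivrMr// mul1r lerD2r.
      apply/rowP => i; rewrite !mxE; case: eqVneq => [->|/oE ->].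
        by rewrite subrr mulr0 addr0.
      by rewrite divfK ?gt_eqF// addrC subrK.
    move=> [t /andP[t0 t1] ->]; apply/edgeP; split=> [i|]; last first.
      by rewrite !mxE eqxx subrr mulr0 addr0.
    rewrite !mxE; case: ifP => _; first by rewrite subrr mulr0 addr0.
    by have := lohi i; nra.
  rewrite (edge_size_segment hM segE) nE dotv2 /L !rotE !mxE eqxx /=.
  have [a0|a0] : (phi l).1 = 0 \/ (phi l).1 = 1.
    by case: (phi l).1 => [[|[|//]]] ?; [left|right]; exact: val_inj.
    rewrite (bigD1 1) ?a0//= big1 ?mulr1; last by case=> [[|[|]]].
    rewrite subrr mul0r add0r; case: ifP => _.
      by rewrite !mulr1 ger0_norm// subr_ge0 ltW.
    by rewrite mulrN1 normrN ger0_norm// subr_ge0 ltW.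
  rewrite (bigD1 0) ?a0//= big1 ?mulr1; last by case=> [[|[|]]].
  rewrite subrr mul0r addr0; case: ifP => _.
    by rewrite mulrN1 normrN ger0_norm// subr_ge0 ltW.
  by rewrite opprK mulr1 ger0_norm// subr_ge0 ltW.
pose F (p : 'I_d * bool) : 'rV[R]_d :=
  L p.1 *: ((if p.2 then 1 else -1) *: 'e_p.1).
transitivity (\sum_(l < nedge K) F (phi l)).
  by apply: eq_bigr => l _; rewrite sizeE nE.
rewrite (_ : \sum_(l < nedge K) F (phi l) = \sum_p F p); last first.
  by rewrite [RHS](reindex phi (onW_bij _ phi_bij)).
rewrite -(pair_bigA _ (fun a s => F (a, s))) /F /=.
by rewrite big1// => a _; rewrite big_bool /= scale1r scaleN1r scalerN subrr.
Qed.

(** * Forward Euler steps with the local operator *)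

(** This is the divergence theorem for constant fields; it allows a scalar flux to be shifted by a
    constant. *)
Lemma structured_normals (R : realType) (d : nat) (Omega : set 'rV[R]_d)
    (M : mesh R d) (K : cell M) :
  mesh_of Omega M -> structured M ->
  \sum_(l < nedge K) edge_size l *: normal l = 0.
Proof.
move=> hM [[d12]|[dE]]; first exact: cartesian_normals hM.
by subst d; exact: triangular_normals hM.
Qed.

(** * The normal flux of a scalar law *)

Lemma diff_dir_comp (R : realType) (U V W : normedModType R) (x v : U)
    (f : U -> V) (g : V -> W) (y : V) (z : W) :
  diff_dir x v f y -> diff_dir (f x) y g z ->
  diff_dir x v (fun u => g (f u)) z.
Proof.
move=> [df <-] [dg <-]; split; first exact: differentiable_comp.
by rewrite (diff_comp df dg).
Qed.

Lemma diff_dir_is_derive (R : realType) (V W : normedModType R) (x v : V)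
    (f : V -> W) (y : W) : diff_dir x v f y -> is_derive x v f y.
Proof.
move=> [df <-]; split; first exact: diff_derivable.
by rewrite deriveE.
Qed.

Lemma differentiable_normal_flux (R : realType) (m d : nat)
    (f : 'rV[R]_m -> 'M[R]_(m, d)) (nu : 'rV[R]_d) (u : 'rV[R]_m) :
  differentiable f u -> differentiable (normal_flux f nu) u.
Proof.
(* The direction 0 makes every directional value trivial, leaving only differentiability to be
   propagated. *)
move=> df; suff [] : diff_dir u 0 (normal_flux f nu) 0 by [].
apply: diff_dir_row => c; rewrite mxE.
under eq_fun do rewrite mxE.
rewrite [X in diff_dir _ _ _ X](_ : _ = \sum_(j < d) 0); last by rewrite big1.
apply: diff_dir_sum => j; under eq_fun do rewrite mxE.
have dfj : diff_dir u 0 (fun u => f u c j) 0.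
  have dc := differentiable_comp df (differentiable_coord (f u) c j).
  by split; [exact: dc|rewrite linear0].
by have := diff_dirM (@diff_dir_cst R _ R u 0 (nu 0 j)) dfj; rewrite !mulr0 addr0.
Qed.

(** The mean value theorem applies between the two states; the Jacobian is a 1 by 1 matrix, whose
    entry is its own eigenvalue and hence bounded in absolute value by [a]. *)
Lemma scalar_flux_lipschitz (R : realType) (d : nat)
    (f : 'rV[R]_1 -> 'M[R]_(1, d)) (lo hi a : R) (nu : 'rV[R]_d)
    (u v : 'rV[R]_1) :
  C1_near f (interval_region lo hi) ->
  ubound (speeds f [set nu] (interval_region lo hi)) a ->
  interval_region lo hi u -> interval_region lo hi v -> u 0 0 <= v 0 0 ->
  `|normal_flux f nu v 0 0 - normal_flux f nu u 0 0| <= a * (v 0 0 - u 0 0).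
Proof.
move=> [U [oU BU fU]] ha /= /andP[u0 u1] /andP[v0 v1] uv.
pose s (x : R) : 'rV[R]_1 := const_mx x.
have sK (w : 'rV[R]_1) : s (w 0 0) = w by apply/rowP => i; rewrite mxE ord1.
pose F := normal_flux f nu; pose J x := 'J F (s x) 0 0.
have s_in x : u 0 0 <= x <= v 0 0 -> interval_region lo hi (s x).
  move=> /andP[ux xv]; rewrite /interval_region /= /s mxE; apply/andP.
  by split; [exact: le_trans u0 ux|exact: le_trans xv v1].
have sJ x : s 1 *m 'J F (s x) = J x *: s 1.
  apply/rowP => i; rewrite ord1 [LHS]mxE big_ord_recl big_ord0 addr0 [RHS]mxE.
  exact: mulrC.
have dF x : u 0 0 <= x <= v 0 0 -> is_derive x 1 (fun y => F (s y) 0 0) (J x).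
  move=> /s_in/BU/fU[df _]; apply: diff_dir_is_derive.
  have ds : diff_dir x (1 : R) s (s 1).
    apply: diff_dir_row => i; rewrite mxE.
    under eq_fun do rewrite mxE.
    by split=> //; rewrite diff_val.
  have dFs : diff_dir (s x) (s 1) F (J x *: s 1).
    have dn := differentiable_normal_flux nu df; split => //.
    by rewrite -sJ /jacobian mul_rV_lin1.
  have := diff_dir_comp (diff_dir_comp ds dFs) (diff_dir_coord _ _ 0).
  by rewrite !mxE mulr1.
have cF : {within `[u 0 0, v 0 0], continuous (fun y => F (s y) 0 0)}.
  apply: derivable_within_continuous => x; rewrite in_itv/= => /dF dFx.
  exact: ex_derive.
have [c cuv] := @MVT_segment R (fun y => F (s y) 0 0) J _ _ uv
  (fun x xuv => dF x (subset_itv_oo_cc xuv)) cF.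
rewrite !sK => ->; rewrite normrM [X in _ * X]ger0_norm ?subr_ge0//.
rewrite ler_wpM2r ?subr_ge0//; apply: ha.
exists nu, (s c), (J c); split => //; first by apply: s_in; rewrite in_itv in cuv.
apply/eigenvalueP; exists (s 1); first exact: sJ.
by apply/eqP => /rowP/(_ 0)/eqP; rewrite !mxE oner_eq0.
Qed.

(** The subtracted terms add up to the flux of [u0] through the whole boundary of the cell, which is
    zero because the scaled normals sum to zero. *)
Lemma cell_average_G_step_shift (R : realType) (m d : nat) (D : dg R m d)
    (f : 'rV[R]_m -> 'M[R]_(m, d)) (u w : dgfun m D) (t : R) (K : cell D)
    (u0 : 'rV[R]_m) :
  quadrature_ok D -> in_V u -> is_G f u w ->
  \sum_(l < nedge K) edge_size l *: normal l = 0 ->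
  cell_average (euler_step u t w) K =
    \sum_(a < nin K) winI a *: u K (xin a) +
    \sum_(l < nedge K) \sum_(b < nedg l) wedgI b *: (trace_int u b -
      (t * edge_size l / vol (body K) / (wedgI b / wB b)) *:
        (normal_flux f (normal l) (trace_int u b) -
         normal_flux f (normal l) u0)).
Proof.
move=> hQ Vu Gw n0; rewrite (cell_average_G_step _ _ hQ Vu Gw).
have [_ hW hB _] := hQ; congr (_ + _).
transitivity (\sum_(l < nedge K) (\sum_(b < nedg l) wedgI b *: (trace_int u b -
      (t * edge_size l / vol (body K) / (wedgI b / wB b)) *:
        normal_flux f (normal l) (trace_int u b)) +
    (t / vol (body K)) *: (edge_size l *: normal_flux f (normal l) u0))).
  rewrite big_split /= -scaler_sumr.
  rewrite [X in _ *: X](_ : _ = 0) ?scaler0 ?addr0//.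
  under eq_bigr do rewrite /normal_flux scalemxAl.
  by rewrite -mulmx_suml n0 mul0mx.
apply: eq_bigr => l _.
(* The quadrature weights of an edge sum to 1, which spreads the edge term over its nodes. *)
rewrite -[X in _ *: (_ *: X)]scale1r -(hB K l) !scaler_suml !scaler_sumr.
rewrite -big_split; apply: eq_bigr => b _ /=.
have [_ /andP[w0 _] B0] := hW K l b.
move: (trace_int u b) (normal_flux _ _ (trace_int u b)) (normal_flux _ _ u0).
move: (vol _)^-1 => v T N N0; apply/rowP => c; rewrite !mxE.
by field; rewrite !gt_eqF.
Qed.

(** The edge factor is at most [lam * mu] and the weight ratio at least [cG], so the product is at
    most [lam mu a0 / cG <= 1]. Only [|t|] enters, which serves both signs of the step. *)
Lemma courant_ratio (R : realType) (m d : nat) (D : dg R m d)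
    (dt lam a0 cG mu t : R) (K : cell D) (l : 'I_(nedge K)) (b : 'I_(nedg l)) :
  quadrature_ok D -> 0 < vol (body K) -> is_max (cfl_ratios D dt) lam ->
  is_min (weight_ratios D) cG -> 0 < dt -> 0 < a0 -> 0 < mu ->
  lam * a0 <= cG / mu -> `|t| = dt * mu ->
  `|t * edge_size l / vol (body K) / (wedgI b / wB b)| * a0 <= 1.
Proof.
move=> [_ hW _ _] vK [_ hlam] [_ hcG] dt0 a00 mu0 hc ht.
have [_ /andP[w0 _] B0] := hW K l b.
have rho0 : 0 < wedgI b / wB b by exact: divr_gt0.
have hl : dt * edge_size l / vol (body K) <= lam by apply: hlam; exists K, l.
have hr : cG <= wedgI b / wB b by apply: hcG; exists K, l, b.
rewrite !normrM !normfV ht (ger0_norm (edge_size_ge0 l)) (gtr0_norm vK).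
rewrite (gtr0_norm rho0) mulrAC ler_pdivrMr// mul1r.
apply: le_trans hr; move: hc; rewrite ler_pdivlMr// => /(le_trans _); apply.
rewrite [leLHS](_ : _ = dt * edge_size l / vol (body K) * (a0 * mu)); last by ring.
by rewrite -[leRHS]mulrA ler_wpM2r// ltW// mulr_gt0.
Qed.

(** Each edge state has the form [u - s f(u).nu] with [|s| a0 <= 1], to which the splitting applies
    with speed [1/|s|], at least [a0]. *)
Lemma G_step_splitting (R : realType) (m d : nat) (D : dg R m d)
    (Omega : set 'rV[R]_d) (f : 'rV[R]_m -> 'M[R]_(m, d)) (B S : set 'rV[R]_m)
    (dt lam a0 cG mu t : R) (u w : dgfun m D) (K : cell D) :
  convex_set B -> LF_splitting f B ->
  mesh_of Omega D -> quadrature_ok D -> is_max (cfl_ratios D dt) lam ->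
  is_min (weight_ratios D) cG -> 0 < dt -> 0 < a0 -> 0 < mu ->
  lam * a0 <= cG / mu -> `|t| = dt * mu ->
  values u `<=` S -> ubound (speeds f (normals D) S) a0 ->
  in_V u -> is_G f u w -> on_S B u K ->
  B (cell_average (euler_step u t w) K).
Proof.
move=> cB LF hM hQ hlam hcG dt0 a00 mu0 hc ht uS ha0 Vu Gw [Bin Bedge].
rewrite (cell_average_G_step _ _ hQ Vu Gw).
apply: (quadrature_mem hM hQ cB) => // l b.
have [_ /(_ K)[_ _ vK] _ _ /(_ K l)[_ [n1 _] _]] := hM.
have := courant_ratio b hQ vK hlam hcG dt0 a00 mu0 hc ht.
(* For [s = 0] the state is the trace itself, and the speed [1/|s|] would be meaningless. *)
set s := _ / _; have [->|s0] := eqVneq s 0; first by rewrite scale0r subr0.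
have sn0 : 0 < `|s| by rewrite normr_gt0.
rewrite -ler_pdivlMl// mulr1 => a0s.
have [||Bp Bm] := LF _ _ `|s|^-1 (Bedge l b) n1; first by rewrite invr_gt0.
  move=> _ [nu [v [e [-> -> ev ->]]]]; apply: le_trans a0s; apply: ha0.
  exists (normal l), (trace_int u b), e; split => //; first by exists K, l.
  by apply: uS; exists K; right; exists l, b; left.
move: Bp Bm; rewrite invrK; have [ss|ss|s00] := ltrgt0P s => Bp Bm.
- exact: Bm.
- by rewrite -scaleNr.
- by rewrite s00 eqxx in s0.
Qed.

(** The two bounds of the interval need different shifts of the flux, so each is proved with its own
    convex half-line. *)
Lemma convex_halfline_ge (R : realType) (lo : R) :
  convex_set [set y : 'rV[R]_1 | lo <= y 0 0].
Proof.
apply/convex_setP => x y t /andP[t0 t1] /= x0 y0; rewrite !mxE; nra.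
Qed.

Lemma convex_halfline_le (R : realType) (hi : R) :
  convex_set [set y : 'rV[R]_1 | y 0 0 <= hi].
Proof.
apply/convex_setP => x y t /andP[t0 t1] /= x0 y0; rewrite !mxE; nra.
Qed.

Lemma G_step_scalar (R : realType) (d : nat) (D : dg R 1 d)
    (Omega : set 'rV[R]_d) (f : 'rV[R]_1 -> 'M[R]_(1, d)) (lo hi : R)
    (dt lam a0 cG mu t : R) (u w : dgfun 1 D) (K : cell D) :
  lo <= hi -> C1_near f (interval_region lo hi) -> structured D ->
  mesh_of Omega D -> quadrature_ok D -> is_max (cfl_ratios D dt) lam ->
  is_min (weight_ratios D) cG -> 0 < dt -> 0 < a0 -> 0 < mu ->
  lam * a0 <= cG / mu -> `|t| = dt * mu ->
  ubound (speeds f (normals D) (interval_region lo hi)) a0 ->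
  in_V u -> is_G f u w -> on_S (interval_region lo hi) u K ->
  interval_region lo hi (cell_average (euler_step u t w) K).
Proof.
move=> lohi fC1 Dst hM hQ hlam hcG dt0 a00 mu0 hc ht ha0 Vu Gw [Bin Bedge].
have n0 := structured_normals K hM Dst.
have [_ /(_ K)[_ _ vK] _ _ _] := hM.
have lip (l : 'I_(nedge K)) (x y : 'rV[R]_1) :=
  @scalar_flux_lipschitz R d f lo hi a0 (normal l) x y fC1.
have ub (l : 'I_(nedge K)) : ubound (speeds f [set normal l] (interval_region lo hi)) a0.
  move=> _ [nu [v [e [-> Bv ev ->]]]]; apply: ha0.
  by exists (normal l), v, e; split => //; exists K, l.
have ratio (l : 'I_(nedge K)) (b : 'I_(nedg l)) :=
  courant_ratio b hQ vK hlam hcG dt0 a00 mu0 hc ht.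
have small (s A B : R) : `|s| * a0 <= 1 -> `|A| <= a0 * B -> `|s * A| <= B.
  move=> s1 AB; rewrite normrM; have B0 : 0 <= B.
    by rewrite -(pmulr_rge0 _ a00) (le_trans _ AB).
  rewrite (@le_trans _ _ (`|s| * (a0 * B)))// ?ler_wpM2l//.
  by rewrite mulrA ler_piMl.
have entry (s : R) (T N N0 : 'rV[R]_1) :
  (T - s *: (N - N0)) 0 0 = T 0 0 - s * (N 0 0 - N0 0 0) by rewrite !mxE.
apply/andP; split.
  have -> := cell_average_G_step_shift t (const_mx lo) hQ Vu Gw n0.
  apply: (quadrature_mem hM hQ (@convex_halfline_ge R lo)) => [a|l b].
    by have /andP[] := Bin a.
  have Bb := Bedge l b; have /andP[b0 b1] := Bb.
  have Blo : interval_region lo hi (const_mx lo).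
    by rewrite /interval_region /= mxE lexx.
  have lob : (const_mx lo : 'rV[R]_1) 0 0 <= trace_int u b 0 0 by rewrite mxE.
  (* At a trace value [T] the shifted flux term is at most [T - lo], so it cannot push the state
     below [lo]; the upper bound is symmetric. *)
  have := small _ _ _ (ratio l b) (lip l _ _ (ub l) Blo Bb lob).
  rewrite ler_norml => /andP[_]; rewrite /= entry.
  by rewrite [const_mx lo 0 0]mxE; lra.
have -> := cell_average_G_step_shift t (const_mx hi) hQ Vu Gw n0.
apply: (quadrature_mem hM hQ (@convex_halfline_le R hi)) => [a|l b].
  by have /andP[] := Bin a.
have Bb := Bedge l b; have /andP[b0 b1] := Bb.
have Bhi : interval_region lo hi (const_mx hi).
  by rewrite /interval_region /= mxE lexx lohi.
have bhi : trace_int u b 0 0 <= (const_mx hi : 'rV[R]_1) 0 0 by rewrite mxE.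
have := small _ _ _ (ratio l b) (lip l _ _ (ub l) Bb Bhi bhi).
rewrite ler_norml => /andP[_]; rewrite /= entry.
by rewrite [const_mx hi 0 0]mxE; lra.
Qed.

(** * From single forward steps to the stage *)

Lemma region_convex (R : realType) (m d : nat) (P : problem R m d)
    (M : mesh R d) : covered P M -> convex_set (region P).
Proof.
case: m d / P M => [d f lo hi|d gamma|m d f B] M /=.
- move=> _; apply/convex_setP => x y t /andP[t0 t1] /andP[x0 x1] /andP[y0 y1].
  by apply/andP; rewrite !mxE; split; nra.
- by move=> [g1 _]; exact: euler_region_convex.
- by case.
Qed.

(** The sign of [t] is free, which covers steps with both signs of the local operator. Scalar laws
    go through the shifted flux, the other problems through the splitting. *)
Lemma G_step_region (R : realType) (m d : nat) (P : problem R m d)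
    (D : dg R m d) (Omega : set 'rV[R]_d) (S : set 'rV[R]_m)
    (dt lam a0 cG mu t : R) (u w : dgfun m D) (K : cell D) :
  covered P D -> mesh_of Omega D -> quadrature_ok D ->
  is_max (cfl_ratios D dt) lam -> is_min (weight_ratios D) cG ->
  0 < dt -> 0 < a0 -> 0 < mu -> lam * a0 <= cG / mu -> `|t| = dt * mu ->
  relevant P [set u] S -> ubound (speeds (flux P) (normals D) S) a0 ->
  in_V u -> is_G (flux P) u w -> on_S (region P) u K ->
  region P (cell_average (euler_step u t w) K).
Proof.
case: m d / P D Omega S u w K => [d f lo hi|d gamma|m d f B] D Omega S u w K /=.
- move=> [lohi fC1 st] hM hQ hl hG dt0 a00 mu0 hc ht ->.
  exact: G_step_scalar hM hQ hl hG dt0 a00 mu0 hc ht.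
- move=> [g1 _] hM hQ hl hG dt0 a00 mu0 hc ht uS.
  apply: (G_step_splitting (euler_region_convex g1) (euler_LF_splitting g1)
    hM hQ hl hG dt0 a00 mu0 hc ht).
  exact: uS.
- move=> [cB _ _ LF] hM hQ hl hG dt0 a00 mu0 hc ht uS.
  apply: (G_step_splitting cB LF hM hQ hl hG dt0 a00 mu0 hc ht).
  exact: uS.
Qed.

(** The set [S] is chosen for all previous stages at once, while each forward step concerns a single
    one. *)
Lemma relevant_sub (R : realType) (m d : nat) (P : problem R m d)
    (D : dg R m d) (us vs : set (dgfun m D)) (S : set 'rV[R]_m) :
  us `<=` vs -> relevant P vs S -> relevant P us S.
Proof.
by case: m d / P D us vs S => [d f lo hi|d gamma|m d f B] D us vs S uv //= vS u
  /uv/vS.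
Qed.

(** The weak property is used with the time step [dt * mu], for which all ratios are multiplied by
    [mu]. *)
Lemma cfl_ratios_scale (R : realType) (d : nat) (M : mesh R d) (dt lam mu : R) :
  0 < mu -> is_max (cfl_ratios M dt) lam ->
  is_max (cfl_ratios M (dt * mu)) (lam * mu).
Proof.
move=> mu0 [[K [l ->]] hlam]; split; first by exists K, l; ring.
move=> _ [K' [l' ->]].
rewrite [leLHS](_ : _ = dt * edge_size l' / vol (body K') * mu); last by ring.
by rewrite ler_pM2r//; apply: hlam; exists K', l'.
Qed.

Theorem lemma3p4 (R : realType) (m d : nat) (P : problem R m d)
    (Omega : set 'rV[R]_d) (D : dg R m d)
    (s : nat) (a : nat -> nat -> R) (b : nat -> R)
    (dt lam a0 cF cG bound : R) (S : set 'rV[R]_m)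
    (un : dgfun m D) (u Fu Gu : nat -> dgfun m D) (i : nat) (K : cell D)
    (thF thP thN muF muP muN : nat -> R)
    (hm : (0 < m)%N) (hd : (0 < d)%N)
    (hP : covered P D)
    (hM : mesh_of Omega D)
    (hk : (1 <= deg D)%N)
    (hQ : quadrature_ok D)
    (hflux : consistent P D)
    (hdt : 0 < dt)
    (hlam : is_max (cfl_ratios D dt) lam)
    (hcG : is_min (weight_ratios D) cG)
    (hcF : 0 < cF)
    (hweak : weak_property P D cF)
    (hRK : cRKDG P s a b dt un u Fu Gu)
    (hi : (1 <= i <= s.+1)%N)
    (hS : relevant P [set v | exists2 j : nat, (1 <= j < i)%N & v = u j] S)
    (ha0 : is_max (speeds (flux P) (normals D) S) a0)
    (ha0_gt0 : 0 < a0)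
    (hth : forall j, (1 <= j < i)%N -> [/\ 0 <= thF j, 0 <= thP j & 0 <= thN j])
    (hth1 : \sum_(1 <= j < i) (thF j + thP j + thN j) = 1)
    (hmu : forall j, (1 <= j < i)%N -> [/\ 0 < muF j, 0 < muP j & 0 < muN j])
    (hconv : cell_average (u i) K = \sum_(1 <= j < i)
       (thF j *: cell_average (euler_step (u j) (dt * muF j) (Fu j)) K
        + thP j *: cell_average (euler_step (u j) (dt * muP j) (Gu j)) K
        + thN j *: cell_average (euler_step (u j) (- (dt * muN j)) (Gu j)) K))
    (hbound : is_min [set r | exists2 j : nat, (1 <= j < i)%N &
       [\/ r = cF / muF j, r = cG / muP j | r = cG / muN j]] bound)
    (hCFL : lam * a0 <= bound) :
  (forall j, (1 <= j < i)%N -> on_Sbar (region P) (u j) K) ->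
  region P (cell_average (u i) K).
Proof.
(* The weights sum to 1, so the claim becomes membership in the weighted cone, to which the stages
   are added one at a time. *)
move=> hB; apply: weighted_in1; rewrite -hth1 hconv.
rewrite big_nat [X in weighted_in _ _ X]big_nat.
have cB := region_convex hP.
have [_ Vu0 hst _ _] := hRK.
apply: weighted_in_sum => // j ji.
(* Even for [i = s + 1] the earlier stages satisfy [j <= s], the range where the method provides
   [Fu j] and [Gu j]. *)
have js : (1 <= j <= s)%N.
  have /andP[j1 j2] := ji; rewrite j1 /=; have /andP[_ i2] := hi.
  by rewrite -ltnS (leq_trans j2).
have [Vu uF uG] := hst j js.
have [thF0 thP0 thN0] := hth j ji; have [muF0 muP0 muN0] := hmu j ji.
have hSj : relevant P [set u j] S.
  by apply: relevant_sub hS => v ->; exists j.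
have bnd x : [\/ x = cF / muF j, x = cG / muP j | x = cG / muN j] ->
    lam * a0 <= x.
  by move=> hx; apply: le_trans hCFL _; have [_] := hbound; apply; exists j.
have [_ ua0] := ha0; have [Sj _] := hB j ji.
(* One statement for both signs: [t] will be [dt * muP j] or [- (dt * muN j)]. *)
have Gstep mu t : 0 < mu -> lam * a0 <= cG / mu -> `|t| = dt * mu ->
    region P (cell_average (euler_step (u j) t (Gu j)) K).
  move=> mu0 hc ht.
  exact: (G_step_region hP hM hQ hlam hcG hdt ha0_gt0 mu0 hc ht hSj ua0 Vu uG).
apply: weighted_inD => //; first apply: weighted_inD => //.
- apply: weighted_in_scale => //.
  apply: (hweak (dt * muF j) (lam * muF j) a0 S) => //.
  + exact: mulr_gt0.
  + exact: cfl_ratios_scale.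
  + by rewrite mulrAC -ler_pdivlMr//; apply: bnd; constructor 1.
  + exact: hB.
- apply: weighted_in_scale => //; apply: (Gstep (muP j)) => //.
    by apply: bnd; constructor 2.
  by rewrite gtr0_norm ?mulr_gt0.
- apply: weighted_in_scale => //; apply: (Gstep (muN j)) => //.
    by apply: bnd; constructor 3.
  by rewrite normrN gtr0_norm ?mulr_gt0.
Qed.
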